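(* Let $\lambda/\mu$ be a skew shape (partitions $\mu\subseteq\lambda$). Then $$s_{\lambda/\mu}(1,q,q^2,\ldots)\;=\;\sum_{S\in\mathcal{E}(\lambda/\mu)}\ \prod_{(i,j)\in[\lambda]\setminus S}\frac{q^{\lambda'_j-i}}{1-q^{h(i,j)}}.$$
   Context: $[\lambda]=\{(i,j):1\le i\le \ell(\lambda),\,1\le j\le\lambda_i\}$ is the Young diagram (rows numbered from the top, columns from the left), $\lambda'$ is the conjugate partition, and $h(i,j)=\lambda_i-i+\lambda'_j-j+1$ is the hook-length of $(i,j)$ in $\lambda$. $s_{\lambda/\mu}(1,q,q^2,\ldots)=\sum_T q^{|T|}$, where the sum is over semistandard Young tableaux $T$ of shape $\lambda/\mu$ with nonnegative integer entries (weakly increasing along rows, strictly increasing down columns) and $|T|$ is the sum of the entries of $T$. Excited diagrams: for $D\subseteq[\lambda]$, a cell $(i,j)\in D$ is active if $(i+1,j)$, $(i,j+1)$, $(i+1,j+1)$ all lie in $[\lambda]\setminus D$; an excited move replaces an active cell $(i,j)$ of $D$ by $(i+1,j+1)$. $\mathcal{E}(\lambda/\mu)$ is the set of all subsets of $[\lambda]$ obtained from $[\mu]$ by a (possibly empty) sequence of excited moves. *)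

(* Defs.v *)
From HB Require Import structures.
From mathcomp Require Import all_boot all_order all_algebra finmap.
From mathcomp Require Import boolp classical_sets functions cardinality fsbigop.

Set Implicit Arguments.
Unset Strict Implicit.
Unset Printing Implicit Defensive.

Import GRing.Theory.

Local Open Scope ring_scope.

Record fps (R : Type) := FPS { fps_coef : nat -> R }.

HB.instance Definition _ (R : Type) := gen_eqMixin (fps R).
HB.instance Definition _ (R : Type) := gen_choiceMixin (fps R).

Lemma fpsP (R : Type) (f g : fps R) :
  (forall n, fps_coef f n = fps_coef g n) <-> f = g.
Proof.
split=> [|-> //]; case: f g => f [g] /= fg.
by congr FPS; apply/funext.
Qed.

Section FpsRing.
Variable R : comNzRingType.
Implicit Types f g h : fps R.

Definition fps_zero : fps R := FPS (fun=> 0).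
Definition fps_one : fps R := FPS (fun n => (n == 0)%:R).
Definition fps_opp f : fps R := FPS (fun n => - fps_coef f n).
Definition fps_add f g : fps R := FPS (fun n => fps_coef f n + fps_coef g n).
Definition fps_mul f g : fps R :=
  FPS (fun n => \sum_(i < n.+1) fps_coef f i * fps_coef g (n - i)).

Fact fps_addA : associative fps_add.
Proof. by move=> f g h; apply/fpsP => n /=; rewrite addrA. Qed.
Fact fps_addC : commutative fps_add.
Proof. by move=> f g; apply/fpsP => n /=; rewrite addrC. Qed.
Fact fps_add0 : left_id fps_zero fps_add.
Proof. by move=> f; apply/fpsP => n /=; rewrite add0r. Qed.
Fact fps_addN : left_inverse fps_zero fps_opp fps_add.
Proof. by move=> f; apply/fpsP => n /=; rewrite addNr. Qed.

HB.instance Definition _ :=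
  GRing.isZmodule.Build (fps R) fps_addA fps_addC fps_add0 fps_addN.

Let trunc f n : {poly R} := \poly_(i < n.+1) fps_coef f i.

Let truncE f n i : (i <= n)%N -> (trunc f n)`_i = fps_coef f i.
Proof. by move=> le_in; rewrite coef_poly ltnS le_in. Qed.

Let trunc_mul f g n m : (m <= n)%N ->
  fps_coef (fps_mul f g) m = (trunc f n * trunc g n)`_m.
Proof.
move=> le_mn; rewrite coefM /=; apply: eq_bigr => i _.
rewrite !truncE ?(leq_trans (leq_subr _ _)) //.
by rewrite (leq_trans _ le_mn) // -ltnS.
Qed.

Fact fps_mulC : commutative fps_mul.
Proof. by move=> f g; apply/fpsP => n; rewrite !(trunc_mul _ _ (leqnn n)) mulrC. Qed.

Fact fps_mulA : associative fps_mul.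
Proof.
move=> f g h; apply/fpsP => n.
have -> : fps_coef (fps_mul f (fps_mul g h)) n =
    (trunc f n * (trunc g n * trunc h n))`_n.
  rewrite coefM /=; apply: eq_bigr => i _.
  by rewrite -(@trunc_mul g h n) ?leq_subr // truncE // -ltnS.
rewrite mulrA coefM /=; apply: eq_bigr => i _.
by rewrite -(@trunc_mul f g n) ?truncE ?leq_subr // -ltnS.
Qed.

Fact fps_mul1 : left_id fps_one fps_mul.
Proof.
move=> f; apply/fpsP => n /=.
rewrite big_ord_recl /= mul1r subn0 big1 ?addr0 // => i _.
by rewrite /= mul0r.
Qed.

Fact fps_mulDl : left_distributive fps_mul fps_add.
Proof.
move=> f g h; apply/fpsP => n /=; rewrite -big_split /=.
by apply: eq_bigr => i _; rewrite mulrDl.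
Qed.

Fact fps_one_neq0 : fps_one != fps_zero.
Proof.
apply/eqP => /fpsP/(_ 0%N) /= /eqP.
by rewrite oner_eq0.
Qed.

HB.instance Definition _ := GRing.Zmodule_isComNzRing.Build (fps R)
  fps_mulA fps_mulC fps_mul1 fps_mulDl fps_one_neq0.

(* As everywhere in the hierarchy, [f^-1 = f] when [f] is not invertible. *)
Definition fps_unit : {pred fps R} := fun f => `[< exists g, g * f = 1 >].
Definition fps_inv f : fps R :=
  if pselect (exists g, g * f = 1) is left fU then xget f [set g | g * f = 1]%classic
  else f.

Fact fps_mulVx : {in fps_unit, left_inverse 1 fps_inv *%R}.
Proof.
move=> f /asboolP fU; rewrite /fps_inv; case: pselect => // -[g gf].
exact: (@xgetPex _ f [set g | g * f = 1]%classic (ex_intro _ g gf)).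
Qed.

Fact fps_unitPl f g : g * f = 1 -> fps_unit f.
Proof. by move=> gf; apply/asboolP; exists g. Qed.

Fact fps_invr_out : {in [predC fps_unit], fps_inv =1 id}.
Proof.
move=> f fNU; rewrite /fps_inv; case: pselect => // fU.
by case/negP: fNU; apply/asboolP.
Qed.

HB.instance Definition _ := GRing.ComNzRing_hasMulInverse.Build (fps R)
  fps_mulVx fps_unitPl fps_invr_out.

Definition fpsX : fps R := FPS (fun n => (n == 1)%:R).

Lemma coef_fpsXn k n : fps_coef (fpsX ^+ k) n = (n == k)%:R.
Proof.
elim: k n => [|k IHk] n; first by rewrite expr0.
rewrite exprS /=; case: n => [|n]; first by rewrite big_ord1 mul0r.
rewrite big_ord_recl mul0r add0r big_ord_recl /= mul1r big1 ?addr0 => [|i _].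
  by rewrite /bump /= subSS subn0 IHk.
by rewrite mul0r.
Qed.

Lemma fps_unit_1subXn k : (0 < k)%N -> 1 - fpsX ^+ k \is a GRing.unit.
Proof.
move=> k_gt0; apply/asboolP; exists (FPS (fun n => (k %| n)%N%:R)).
rewrite mulrBr mulr1; apply/fpsP => n.
set g := FPS _; have -> : fps_coef (g - g * fpsX ^+ k) n =
   fps_coef g n - \sum_(i < n.+1) fps_coef g i * fps_coef (fpsX ^+ k) (n - i).
  by [].
under eq_bigr => i _ do rewrite coef_fpsXn.
have [lt_nk|le_kn] := ltnP n k.
  rewrite big1 => [|i _]; last first.
    by rewrite ltn_eqF ?mulr0 // (leq_ltn_trans (leq_subr _ _)).
  rewrite subr0 /=; case: n lt_nk => [|n] lt_nk; first by rewrite dvdn0.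
  by rewrite gtnNdvd.
have lt_nkn : (n - k < n.+1)%N by rewrite ltnS leq_subr.
rewrite (bigD1 (Ordinal lt_nkn)) //= subKn // eqxx mulr1 big1 => [|i].
  rewrite addr0 -{1}(subnK le_kn) dvdn_addl ?dvdnn // subrr.
  by rewrite gtn_eqF // (leq_trans k_gt0).
rewrite -val_eqE /= => ne_i; case: eqP => [E|]; last by rewrite mulr0.
by case/eqP: ne_i; rewrite -E subKn // -ltnS.
Qed.

(* Sum of a possibly infinite family that is summable, i.e. such that every
   power of q occurs in finitely many members: coefficientwise finite sum.
   ([\sum_(i \in A)] is 0 where the support is infinite.) *)
Definition fps_sum (I : choiceType) (A : set I) (F : I -> fps R) : fps R :=
  FPS (fun n => \sum_(i \in A) fps_coef (F i) n).

End FpsRing.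

Arguments fpsX {R}.

(* A partition is the list of its nonzero parts; rows and columns are numbered
   from 1, so [part la i] is only meaningful for [0 < i]. *)

Local Open Scope nat_scope.
Local Open Scope fset_scope.

Definition is_partition (la : seq nat) : bool := sorted geq la && (0 \notin la).

Definition part (la : seq nat) (i : nat) : nat := nth 0 la i.-1.

Definition conj_part (la : seq nat) (j : nat) : nat := count (leq j) la.

Definition young (la : seq nat) : {fset nat * nat} :=
  [fset c in [seq (i, j) | i <- iota 1 (size la), j <- iota 1 (part la i)]].

(* Both truncated differences are exact when [c] is a cell of [la]. *)
Definition hook (la : seq nat) (c : nat * nat) : nat :=
  (part la c.1 - c.2) + (conj_part la c.2 - c.1) + 1.

Definition active (la : seq nat) (D : {fset nat * nat}) (c : nat * nat) : bool :=
  [&& c \in D, (c.1.+1, c.2) \in young la `\` D,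
      (c.1, c.2.+1) \in young la `\` D & (c.1.+1, c.2.+1) \in young la `\` D].

Definition excite (D : {fset nat * nat}) (c : nat * nat) : {fset nat * nat} :=
  (c.1.+1, c.2.+1) |` (D `\ c).

Inductive excited (la mu : seq nat) : {fset nat * nat} -> Prop :=
| excited_init : excited la mu (young mu)
| excited_move D c :
    excited la mu D -> active la D c -> excited la mu (excite D c).

Definition excited_diagrams (la mu : seq nat) : {fset {fset nat * nat}} :=
  [fset D in fpowerset (young la) | `[< excited la mu D >]].

Definition skew (la mu : seq nat) : {fset nat * nat} := young la `\` young mu.

Definition ssyt (la mu : seq nat) : set {ffun skew la mu -> nat} :=
  [set T : {ffun skew la mu -> nat} |
    (forall c d : skew la mu,
        (val c).1 = (val d).1 -> (val c).2 <= (val d).2 -> T c <= T d) /\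
    (forall c d : skew la mu,
        (val c).2 = (val d).2 -> (val c).1 < (val d).1 -> T c < T d)]%classic.

Definition weight (la mu : seq nat) (T : {ffun skew la mu -> nat}) : nat :=
  \sum_(c : skew la mu) T c.

Definition skew_schur_ps (la mu : seq nat) : fps int :=
  fps_sum (@ssyt la mu) (fun T => fpsX ^+ weight T)%R.

(* The family defining [skew_schur_ps] is summable. *)
Lemma ssyt_weight_finite (la mu : seq nat) (n : nat) :
  finite_set [set T | ssyt T /\ @weight la mu T = n]%classic.
Proof.
pose e (f : {ffun skew la mu -> 'I_n.+1}) : {ffun skew la mu -> nat} :=
  [ffun c => val (f c)].
apply: (@sub_finite_set _ _ [set e f | f in [set: _]]%classic); last first.
  exact/finite_image/finite_finset.
move=> T /= [_ wT].
have Tn c : T c < n.+1 by rewrite ltnS -wT /weight (bigD1 c) //= leq_addr.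
exists [ffun c => Ordinal (Tn c)] => //; apply/ffunP => c.
by rewrite !ffunE.
Qed.

(* Main.v *)
(* Idea.  Both sides are identified with the determinant
     D(mu) = det [ h_(l_j - m_i) ],   h_n = 1 / ((1-q)...(1-q^n)),  h_n = 0 for n < 0,
   where l_i = la_i + d - i and m_i = mu_i + d - i are the shifted parts.

   Tableaux side.  Peeling off the zeros of a tableau and decreasing the other entries
   gives s_(la/mu) = sum_nu q^|la/nu| s_(la/nu) over the nu with nu/mu a horizontal
   strip.  D satisfies the same recurrence: since q^n h_n = h_n - h_(n-1), the sum over
   the interlacing range telescopes to a difference of two consecutive rows of the matrix.

   Excited side.  An excited diagram is a reverse plane partition e on mu, the cell
   (i,j) being slid to (i + e, j + e).  Removing a corner (r,c) of la, for arbitrary row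
   and column weights x_i, y_j,
     G(la, mu) = G(la - (r,c), mu) + (y_c - x_r) G(la - (r,c), mu - corner),
   where the corner of mu lies on the diagonal of (r,c), and the last term is absent if
   there is none.  The determinants det [ prod_(k < m_i) (t_k - x_j) ], with t listing
   the x_i and y_j along the boundary of la, satisfy the same recurrence, removal of the
   corner transposing two consecutive t's.  Hence they equal G(la, mu) up to a factor
   independent of mu; the case t_k = q^k is D(mu) up to explicit factors, and comparison
   with mu = la removes the unknown one. *)

From mathcomp Require Import all_boot all_order all_algebra finmap.
From mathcomp Require Import boolp classical_sets fsbigop.
From mathcomp Require Import zify ring.
Require Import Defs.

Set Implicit Arguments.
Unset Strict Implicit.
Unset Printing Implicit Defensive.

Import GRing.Theory.

Local Open Scope fset_scope.
Local Open Scope nat_scope.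

(** * Excited diagrams as reverse plane partitions *)

Definition noninc (mu : nat -> nat) := forall i, mu i.+1 <= mu i.

Definition cell (mu : nat -> nat) (c : nat * nat) :=
  [&& 0 < c.1, 0 < c.2 & c.2 <= mu c.1].

Lemma noninc_le mu i j : noninc mu -> i <= j -> mu j <= mu i.
Proof.
move=> mu_ni /subnK <-; elim: (j - i) => [|k IH] //; rewrite addSn; exact: leq_trans (mu_ni _) IH.
Qed.

Lemma cell_down mu i j c : noninc mu -> cell mu c ->
  0 < i <= c.1 -> 0 < j <= c.2 -> cell mu (i, j).
Proof.
move=> mu_ni /and3P[_ _ c2] /andP[i0 ic] /andP[j0 jc].
rewrite /cell /= i0 j0; have := noninc_le mu_ni ic; lia.
Qed.

Definition slide (e : nat * nat -> nat) (c : nat * nat) := (c.1 + e c, c.2 + e c).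

Definition rpp (mu : nat -> nat) (e : nat * nat -> nat) :=
  forall c c', cell mu c -> cell mu c' -> c.1 <= c'.1 -> c.2 <= c'.2 -> e c <= e c'.

Definition slides mu e (S : {fset nat * nat}) :=
  forall z, z \in S <-> exists2 c, cell mu c & z = slide e c.

Definition slid_diagram (lam mu : nat -> nat) (S : {fset nat * nat}) :=
  exists e, [/\ rpp mu e, slides mu e S & forall z, z \in S -> cell lam z].

(** Cells with the same image lie on one diagonal, and of two such cells the lower one slides at
    least as far as the upper one. *)
Lemma slide_inj mu e c c' : rpp mu e -> cell mu c -> cell mu c' ->
  slide e c = slide e c' -> c = c'.
Proof.
move=> rppe; case: c c' => i j [i' j'] ci ci' [].
have := rppe _ _ ci ci'; have := rppe _ _ ci' ci; rewrite /=.
by case: (leqP i i') => ? h h' E1 E2; congr pair; lia.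
Qed.

(** By induction on the moves: a move applied to the image of [c0] raises [e c0] by one. *)
Lemma excited_slides la mu D : noninc (part mu) ->
  (forall z, (z \in young mu) = cell (part mu) z) ->
  excited la mu D -> exists2 e, rpp (part mu) e & slides (part mu) e D.
Proof.
move=> mu_ni youngE; elim=> [|{}D c _ [e rppe De] /and4P[cD c10 c01 _]].
  exists (fun=> 0) => // z; rewrite youngE; split=> [zmu|[[i j] cz ->]].
    by exists z => //; case: z zmu => i j; rewrite /slide !addn0.
  by rewrite /slide !addn0.
have [c0 c0mu cE] := (De c).1 cD.
(* This keeps the raised [e] monotone: were [e c1 = e c0], the right or lower neighbour of [c0]
   would share this displacement, and its image would occupy a position that activity requires to be
   empty. *)
have strict c1 : cell (part mu) c1 -> c1 != c0 -> c0.1 <= c1.1 -> c0.2 <= c1.2 ->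
    e c0 < e c1.
  move=> c1mu c1c0 le1 le2; rewrite ltn_neqAle rppe // andbT; apply/negP=> /eqP Ee.
  have [c01' c02'] : 0 < c0.1 /\ 0 < c0.2 by case/and3P: c0mu.
  have [lt2|le2'] := ltnP c0.2 c1.2.
    have mem : cell (part mu) (c0.1, c0.2.+1) by apply: cell_down c1mu _ _ => //=; lia.
    move: c01; rewrite inE => /andP[/negP + _]; apply; apply/De.
    exists (c0.1, c0.2.+1) => //; rewrite cE /slide /=.
    have := rppe _ _ mem c1mu le1 lt2.
    have := rppe _ _ c0mu mem (leqnn _) (leqnSn _); rewrite Ee => h1 h2.
    by congr pair; lia.
  have lt1 : c0.1 < c1.1.
    move: c1c0; case: (c0) (c1) le1 le2 le2' => [a b] [a' b'] /=.
    by rewrite xpair_eqE; lia.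
  have mem : cell (part mu) (c0.1.+1, c0.2) by apply: cell_down c1mu _ _ => //=; lia.
  move: c10; rewrite inE => /andP[/negP + _]; apply; apply/De.
  exists (c0.1.+1, c0.2) => //; rewrite cE /slide /=.
  have := rppe _ _ mem c1mu lt1 le2.
  have := rppe _ _ c0mu mem (leqnSn _) (leqnn _); rewrite Ee => h1 h2.
  by congr pair; lia.
pose e' z := e z + (z == c0).
exists e' => [z z' zmu z'mu le1 le2|z].
  rewrite /e'; have [E|_] := eqVneq z c0; last by have := rppe _ _ zmu z'mu le1 le2; lia.
  have [-> //|ne] := eqVneq z' c0; first by rewrite E.
  by rewrite addn1 addn0; subst z; apply: strict.
rewrite /excite !inE; split.
  case/orP=> [/eqP->|/andP[zc zD]].
    by exists c0 => //; rewrite /slide /e' eqxx cE /slide /= !addn1 !addnS.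
  have [c1 c1mu zE] := (De z).1 zD; exists c1 => //.
  rewrite /slide /e'; case: eqVneq => [E|_]; last by rewrite !addn0.
  by case/eqP: zc; rewrite zE E cE.
case=> c1 c1mu ->; rewrite {1 2 3}/slide /e'.
have [->|ne] := eqVneq c1 c0.
  by rewrite !addn1 !addnS cE /slide eqxx.
apply/orP; right; rewrite addn0; apply/andP; split.
  apply/eqP => E; case/eqP: ne; apply: (slide_inj rppe c1mu c0mu).
  by rewrite -cE.
by apply/De; exists c1.
Qed.

(** Induction on the total displacement [k], which is the number of moves leading from [young mu] to
    [D]. *)
Lemma slides_excited la mu e D : noninc (part mu) -> noninc (part la) ->
  (forall z, (z \in young mu) = cell (part mu) z) ->
  (forall z, (z \in young la) = cell (part la) z) ->
  rpp (part mu) e -> slides (part mu) e D -> {subset D <= young la} ->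
  excited la mu D.
Proof.
move=> mu_ni la_ni muE laE.
move Ek : (\sum_(c <- young mu) e c) => k.
elim: k => [|k IH] in e D Ek * => rppe De Dla.
  suff -> : D = young mu by exact: excited_init.
  have e0 c : cell (part mu) c -> e c = 0.
    move=> cmu; have cy : c \in young mu by rewrite muE.
    by move: Ek; rewrite (big_fsetD1 c) //=; lia.
  apply/fsetP => z; rewrite muE; apply/idP/idP => [/De[c cmu ->]|zmu].
    by rewrite /slide e0 // !addn0; case: (c) cmu.
  by apply/De; exists z => //; rewrite /slide e0 // !addn0; case: (z).
(* The last move is undone at a cell that is minimal among the displaced ones. *)
have [c0 [c0mu ec0 min0]] : exists c0, [/\ cell (part mu) c0, 0 < e c0 &
    forall c, cell (part mu) c -> 0 < e c -> c0.1 + c0.2 <= c.1 + c.2].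
  have ex : exists n, `[< exists c, [/\ cell (part mu) c, 0 < e c & c.1 + c.2 = n] >].
    have /hasP[c cy ec] : has (fun c => 0 < e c) (young mu).
      apply/negPn/negP=> /hasPn no; move: Ek; rewrite big_seq big1 // => c cy.
      by have := no c cy; lia.
    exists (c.1 + c.2); apply/asboolP; exists c; split=> //; by rewrite -muE.
  case: (ex_minnP ex) => n /asboolP[c [cmu ec cn]] nmin.
  exists c; split=> // c' c'mu ec'; rewrite cn; apply: nmin; apply/asboolP.
  by exists c'.
have c0y : c0 \in young mu by rewrite muE.
pose e' z := if z == c0 then (e z).-1 else e z.
have e'c0 : e' c0 = (e c0).-1 by rewrite /e' eqxx.
have e'ne z : z != c0 -> e' z = e z by rewrite /e' => /negbTE->.
(* By minimality of [c0] the other cells weakly above and to the left of it have displacement 0, so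
   lowering [e c0] preserves monotonicity. *)
have rppe' : rpp (part mu) e'.
  move=> z z' zmu z'mu le1 le2; have := rppe _ _ zmu z'mu le1 le2.
  have [E'|ne'] := eqVneq z' c0; last first.
    have [->|ne] := eqVneq z c0; last by rewrite !e'ne.
    by rewrite e'c0 e'ne //; lia.
  have [->|ne] := eqVneq z c0; first by rewrite E'.
  rewrite E' e'c0 e'ne // => _; move: ne; rewrite -E'.
  have := min0 _ zmu; rewrite -E'.
  case: (z) (z') le1 le2 => [a b] [a' b'] /=; rewrite xpair_eqE.
  by move: (e _) (e _); lia.
pose c := slide e' c0.
have ecE : e c0 = (e' c0).+1 by lia.
have cE : slide e c0 = (c.1.+1, c.2.+1) by rewrite /c /slide ecE !addnS.
have cD : slide e c0 \in D by apply/De; exists c0.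
pose D' := c |` (D `\ slide e c0).
have D'e' : slides (part mu) e' D'.
  move=> z; rewrite !inE; split.
    case/orP=> [/eqP->|/andP[ne /De[c1 c1mu zE]]]; first by exists c0.
    exists c1 => //; rewrite zE /slide e'ne //.
    by apply: contra_neq ne => E; rewrite zE E.
  case=> c1 c1mu ->; have [->|ne] := eqVneq c1 c0; first by rewrite eqxx.
  apply/orP; right; apply/andP; split.
    apply: contra_neq ne => E; apply: (slide_inj rppe) => //.
    rewrite -E /slide e'ne //; apply: contra_eqN E => /eqP ->.
    by rewrite /slide ecE; apply/eqP => -[]; lia.
  apply/De; exists c1 => //; by rewrite /slide e'ne.
have c_la : cell (part la) (c.1.+1, c.2.+1) by rewrite -laE; apply: Dla; rewrite -cE.
have [c0pos1 c0pos2] : 0 < c0.1 /\ 0 < c0.2 by case/and3P: c0mu.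
have cpos : 0 < c.1 /\ 0 < c.2 by rewrite /c /slide /=; lia.
have subla a b : 0 < a <= c.1.+1 -> 0 < b <= c.2.+1 -> (a, b) \in young la.
  by move=> ha hb; rewrite laE; apply: cell_down c_la _ _.
(* A cell other than [c0] sliding to one of these positions lies weakly northwest or southeast of
   [c0]; monotonicity of [e'] excludes the first case, that of [e] the second. *)
have notin (a b : nat) : (a, b) \in [:: (c.1.+1, c.2); (c.1, c.2.+1); (c.1.+1, c.2.+1)] ->
    (a, b) \notin D'.
  move=> abE; apply/negP=> /D'e'[c1 c1mu].
  have [->|ne] := eqVneq c1 c0.
    by move: abE; rewrite !inE /c !xpair_eqE /slide /= => abE []; lia.
  have := rppe' _ _ c1mu c0mu; have := rppe _ _ c0mu c1mu.
  move: abE; rewrite /slide !(e'ne c1) // !inE /c /slide !xpair_eqE /= ecE.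
  move: (e' c0) (e c1) ne => x y; case: (c1) (c0) => [i j] [i0 j0] /=.
  by rewrite xpair_eqE => ne abE h1 h2 []; lia.
have DE : D = excite D' c.
  apply/fsetP => z; rewrite /excite -cE /D' !inE.
  have [->|ne] := eqVneq z (slide e c0); first by rewrite cD.
  have [->|//] := eqVneq z c; apply/negP => /De[c1 c1mu].
  have := rppe' _ _ c1mu c0mu; have := rppe _ _ c0mu c1mu.
  have [->|ne1] := eqVneq c1 c0; first by rewrite /c /slide => _ _ [] /=; lia.
  rewrite (e'ne c1) // /c /slide /= ecE; move: (e' c0) (e c1) ne1 => x y.
  case: (c1) (c0) => [i j] [i0 j0] /=; rewrite xpair_eqE => ne1 h1 h2 []; lia.
rewrite DE; apply: excited_move; last first.
  have inD a b : (a, b) \in [:: (c.1.+1, c.2); (c.1, c.2.+1); (c.1.+1, c.2.+1)] ->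
      (a, b) \in young la `\` D'.
    move=> abE; rewrite in_fsetD notin //= subla //;
    by move: abE; rewrite !inE !xpair_eqE; lia.
  by rewrite /active fset1U1 !inD // !inE eqxx ?orbT.
apply: (IH e') => //.
  move: Ek; rewrite (big_fsetD1 c0) //= [in X in _ -> X](big_fsetD1 c0) //= e'c0.
  have -> : \sum_(i <- young mu `\ c0) e' i = \sum_(i <- young mu `\ c0) e i.
    by apply: eq_big_seq => z; rewrite !inE => /andP[/e'ne].
  by move: (\sum_(i <- _) _) (e c0) ec0 => s n; lia.
move=> z; rewrite in_fset1U in_fsetD1 => /orP[/eqP->|/andP[_ /Dla]//].
by have := subla c.1 c.2; rewrite -surjective_pairing; apply; lia.
Qed.

(** * Removing a corner *)

Definition decr (mu : nat -> nat) (r i : nat) := if i == r then (mu i).-1 else mu i.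

Definition corner (mu : nat -> nat) (r : nat) := (0 < r) && (mu r.+1 < mu r).

Lemma cell_decr mu r z : corner mu r ->
  cell (decr mu r) z = cell mu z && (z != (r, mu r)).
Proof.
case: z => i j /andP[r0 mur]; rewrite /cell /decr xpair_eqE /=.
by case: eqP => [->|_] /=; [lia | rewrite andbT].
Qed.

Lemma noninc_decr mu r : noninc mu -> corner mu r -> noninc (decr mu r).
Proof.
move=> mu_ni /andP[r0 mur] i; rewrite /decr.
have := mu_ni i; case: (eqVneq i.+1 r) => _; case: eqP => [E|_]; try lia.
by move: mur; rewrite -E; lia.
Qed.

Section Corner.
Variables (lam mu : nat -> nat) (r : nat).
Hypotheses (lam_ni : noninc lam) (mu_ni : noninc mu) (lam_r : corner lam r).

Let corner_cell : cell lam (r, lam r).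
Proof. by case/andP: lam_r => r0 lamr; rewrite /cell /= r0 leqnn andbT; lia. Qed.

Lemma slid_diagram_decr S :
  slid_diagram (decr lam r) mu S <->
  slid_diagram lam mu S /\ (r, lam r) \notin S.
Proof.
split=> [[e [rppe Se sub]]|[[e [rppe Se sub]] nS]].
  split; first by exists e; split=> // z /sub; rewrite cell_decr // => /andP[].
  by apply/negP => /sub; rewrite cell_decr // eqxx andbF.
exists e; split=> // z zS; rewrite cell_decr // sub //=.
by apply: contraNneq nS => <-.
Qed.

(** The cell of [mu] that slides to the corner of [lam] is itself a corner: a right or lower
    neighbour would slide at least as far and leave [lam]. *)
Lemma slid_diagram_corner S : slid_diagram lam mu S -> (r, lam r) \in S ->
  exists i, [/\ corner mu i, mu i + r = i + lam r
              & slid_diagram (decr lam r) (decr mu i) (S `\ (r, lam r))].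
Proof.
case/andP: (lam_r) => r0 lamr [e [rppe Se sub]] /[dup] rS /Se[[i j] ijmu [rE cE]].
have /and3P[/= i0 j0 jmu] := ijmu.
have jE : mu i = j.
  apply/eqP; rewrite eqn_leq jmu andbT leqNgt; apply/negP=> lt_j.
  have c1 : cell mu (i, j.+1) by rewrite /cell /= i0.
  have le_e := rppe _ _ ijmu c1 (leqnn _) (leqnSn _).
  have : slide e (i, j.+1) \in S by apply/Se; exists (i, j.+1).
  move/sub; move=> /and3P[/= _ _ +].
  have : r <= i + e (i, j.+1) by lia.
  by move/(noninc_le lam_ni); lia.
have mui : mu i.+1 < mu i.
  rewrite ltnNge; apply/negP=> le_i.
  have c1 : cell mu (i.+1, j) by rewrite /cell /= j0; lia.
  have le_e := rppe _ _ ijmu c1 (leqnSn _) (leqnn _).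
  have : slide e (i.+1, j) \in S by apply/Se; exists (i.+1, j).
  move/sub; move=> /and3P[/= _ _ +].
  have : r.+1 <= i.+1 + e (i.+1, j) by lia.
  by move/(noninc_le lam_ni); lia.
have mu_i : corner mu i by rewrite /corner i0.
exists i; split=> //; first by rewrite jE; lia.
exists e; split.
- move=> z z'; rewrite !cell_decr // => /andP[zmu _] /andP[z'mu _].
  exact: rppe.
- move=> z; rewrite in_fsetD1; split.
    case/andP=> zr /Se[w wmu zE]; exists w => //; rewrite cell_decr // wmu /=.
    apply: contra_neq zr => E; rewrite zE E jE.
    by rewrite /slide /= -rE -cE.
  case=> w; rewrite cell_decr // jE => /andP[wmu ne] ->; apply/andP; split.
    apply: contra_neq ne => E; apply: (slide_inj rppe wmu ijmu).
    by rewrite E /slide /= -rE -cE.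
  by apply/Se; exists w.
- move=> z; rewrite in_fsetD1 cell_decr // => /andP[ne /sub->].
  by rewrite ne.
Qed.

(** The corner of [mu] is put back with displacement [r - i], which takes it to [(r, lam r)]. *)
Lemma slid_diagram_add S i : corner mu i -> mu i + r = i + lam r ->
  slid_diagram (decr lam r) (decr mu i) S -> slid_diagram lam mu ((r, lam r) |` S).
Proof.
move=> mu_i diag [e [rppe Se sub]]; have /andP[i0 mui] := mu_i.
have /andP[r0 lamr] := lam_r.
(* If [r < i], then [(r, lam r)] is a cell of [decr mu i], but no displacement of it stays inside
   [decr lam r]. *)
have [le_ir|lt_ri] := leqP i r; last first.
  have cz : cell (decr mu i) (r, lam r).
    apply: (@cell_down _ _ _ (r, lam r)); rewrite ?leqnn ?r0 //=; try lia.
      exact: noninc_decr.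
    rewrite cell_decr // /cell /= r0 xpair_eqE.
    have := noninc_le mu_ni (ltnW lt_ri); lia.
  have : slide e (r, lam r) \in S by apply/Se; exists (r, lam r).
  move/sub; rewrite cell_decr // => /andP[+ ne]; rewrite /slide /cell /= in ne *.
  have /(noninc_le lam_ni) : r <= r + e (r, lam r) by lia.
  by move: ne; rewrite xpair_eqE; lia.
pose e' z := if z == (i, mu i) then r - i else e z.
have e'ne z : z != (i, mu i) -> e' z = e z by rewrite /e' => /negbTE->.
have e'i : e' (i, mu i) = r - i by rewrite /e' eqxx.
have slide_i : slide e' (i, mu i) = (r, lam r).
  by rewrite /slide e'i /=; congr pair; lia.
have cellE z : cell mu z -> z != (i, mu i) -> cell (decr mu i) z.
  by move=> zmu ne; rewrite cell_decr // zmu.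
exists e'; split.
- move=> z z' zmu z'mu le1 le2.
  have [zE|ne] := eqVneq z (i, mu i).
    suff -> : z' = z by [].
    move: z'mu le1 le2; rewrite zE; case: (z') => a b /and3P[/= _ _ le_b] le_a le_mu.
    have [lt_ia|le_ai] := ltnP i a; last first.
      have aE : a = i by lia.
      by rewrite aE; congr pair; move: le_b; rewrite aE; lia.
    by have := noninc_le mu_ni lt_ia; lia.
  have [z'E|ne'] := eqVneq z' (i, mu i); last first.
    by rewrite !e'ne //; apply: rppe => //; exact: cellE.
  rewrite z'E e'i e'ne //; have zmu' := cellE _ zmu ne.
  (* Cells southeast of [z] slide at least as far as [z]. If [e z > r - i], the neighbour above the
     corner of [mu] or the one to its left, slid by [e z], would lie outside [lam]. *)
  have bound w : cell mu w -> w != (i, mu i) -> z.1 <= w.1 -> z.2 <= w.2 ->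
      cell lam (w.1 + e z, w.2 + e z).
    move=> wmu nw lew1 lew2; have wmu' := cellE _ wmu nw.
    have : slide e w \in S by apply/Se; exists w.
    move/sub; rewrite cell_decr // => /andP[slw _].
    have le_e := rppe _ _ zmu' wmu' lew1 lew2; have /and3P[w1 w2 _] := wmu.
    by apply: cell_down slw _ _ => //=; rewrite /slide /=; lia.
  have /and3P[z1 z2 _] := zmu; rewrite z'E /= in le1 le2.
  rewrite leqNgt; apply/negP=> lt_e; have [lt_zi|le_iz] := ltnP z.1 i.
    have wmu : cell mu (i.-1, mu i).
      by have := noninc_le mu_ni (leq_pred i); rewrite /cell /=; lia.
    have /and3P[/= _ _] : cell lam (i.-1 + e z, mu i + e z).
      by apply: (bound (i.-1, mu i)) => //=; rewrite ?xpair_eqE; lia.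
    have /(noninc_le lam_ni) : r <= i.-1 + e z by lia.
    by lia.
  have lt_z2 : z.2 < mu i.
    move: ne le1 le2 le_iz; case: (z) => a b /=; rewrite xpair_eqE; lia.
  have wmu : cell mu (i, (mu i).-1) by rewrite /cell /=; lia.
  have /and3P[/= _ _] : cell lam (i + e z, (mu i).-1 + e z).
    by apply: (bound (i, (mu i).-1)) => //=; rewrite ?xpair_eqE; lia.
  have /(noninc_le lam_ni) : r.+1 <= i + e z by lia.
  by lia.
- move=> z; rewrite in_fset1U; split.
    case/orP=> [/eqP->|/Se[w]].
      exists (i, mu i); rewrite ?slide_i // /cell /= i0; lia.
    rewrite cell_decr // => /andP[wmu ne] ->; exists w => //.
    by rewrite /slide e'ne.
  case=> w wmu ->; have [->|ne] := eqVneq w (i, mu i); first by rewrite slide_i eqxx.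
  apply/orP; right; apply/Se; exists w; first exact: cellE.
  by rewrite /slide e'ne.
- move=> z; rewrite in_fset1U => /orP[/eqP->//|/sub].
  by rewrite cell_decr // => /andP[].
Qed.

End Corner.

(* The convention [mu 0 = N] makes the interlacing condition
   [mu i.+1 <= nu i.+1 <= mu i] uniform in [i]. *)
Definition is_shape (d N : nat) (mu : nat -> nat) :=
  [/\ noninc mu, mu 0 = N & mu d.+1 = 0].

Definition cells (d : nat) (mu : nat -> nat) : {fset nat * nat} :=
  [fset c in [seq (i, j) | i <- iota 1 d, j <- iota 1 (mu i)]].

Lemma mem_cells d mu c : (c \in cells d mu) = (c.1 <= d) && cell mu c.
Proof.
case: c => i j; rewrite in_fset /=; apply/allpairsPdep/idP.
  by case=> i' [j' [+ + [-> ->]]]; rewrite !mem_iota /cell /=; lia.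
rewrite /cell /= => /and4P[id i0 j0 jmu].
by exists i, j; rewrite !mem_iota; split=> //; lia.
Qed.

Lemma shape_out d N mu i : is_shape d N mu -> d < i -> mu i = 0.
Proof. by case=> mu_ni _ mud /(noninc_le mu_ni); rewrite mud; lia. Qed.

Lemma shape_le d N mu i : is_shape d N mu -> mu i <= N.
Proof. by case=> mu_ni <- _; apply: noninc_le. Qed.

Lemma cell_row d N mu c : is_shape d N mu -> cell mu c -> c.1 <= d.
Proof.
move=> mu_sh /and3P[_ c2 cmu]; have [//|/(shape_out mu_sh) mu0] := leqP c.1 d.
by rewrite mu0 in cmu; lia.
Qed.

Lemma mem_shape d N mu c : is_shape d N mu -> (c \in cells d mu) = cell mu c.
Proof.
by move=> mu_sh; rewrite mem_cells andb_idl // => /(cell_row mu_sh).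
Qed.

Lemma shape_decr d N mu r : is_shape d N mu -> corner mu r -> is_shape d N (decr mu r).
Proof.
move=> [mu_ni mu0 mud] mu_r; split; first exact: noninc_decr.
  by rewrite /decr; case: eqP mu_r => [<-|//]; rewrite /corner ltnn.
by rewrite /decr mud; case: eqP.
Qed.

Definition slid_diagrams (d : nat) (lam mu : nat -> nat) : {fset {fset nat * nat}} :=
  [fset S in fpowerset (cells d lam) | `[< slid_diagram lam mu S >]].

Lemma slid_diagramsP d N lam mu S : is_shape d N lam ->
  reflect (slid_diagram lam mu S) (S \in slid_diagrams d lam mu).
Proof.
move=> lam_sh; rewrite !inE /=; apply: (iffP andP) => [[_ /asboolP]//|slS].
split; last exact/asboolP; rewrite fpowersetE; apply/fsubsetP => z zS.
by case: slS => e [_ _ /(_ z zS)]; rewrite (mem_shape _ lam_sh).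
Qed.

(** The differences [mu i - i] strictly decrease, so at most one row ends on a given diagonal. *)
Lemma diag_inj mu i i' r s : noninc mu ->
  mu i + r = i + s -> mu i' + r = i' + s -> i = i'.
Proof.
move=> mu_ni; case: (ltngtP i i') => // /[dup] ? /ltnW/(noninc_le mu_ni); lia.
Qed.

(** * The corner recurrence for weighted sums over excited diagrams *)

Section GenericSum.
Variables (K : comNzRingType) (d N : nat) (w : nat * nat -> K).

Definition slid_sum (lam mu : nat -> nat) : K :=
  (\sum_(S <- slid_diagrams d lam mu) \prod_(c <- S) w c)%R.

Variables (lam mu : nat -> nat) (r : nat).
Hypotheses (lam_sh : is_shape d N lam) (mu_sh : is_shape d N mu) (lam_r : corner lam r).

Let lam_ni : noninc lam. Proof. by case: lam_sh. Qed.
Let mu_ni : noninc mu. Proof. by case: mu_sh. Qed.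
Let lam'_sh : is_shape d N (decr lam r). Proof. exact: shape_decr. Qed.

Lemma slid_sum_skip :
  (forall i, corner mu i -> mu i + r <> i + lam r) ->
  slid_sum lam mu = slid_sum (decr lam r) mu.
Proof.
move=> no_i; rewrite /slid_sum; congr bigop; congr enum_fset.
apply/fsetP => S; apply/(slid_diagramsP _ _ lam_sh)/(slid_diagramsP _ _ lam'_sh).
  move=> slS; apply/(slid_diagram_decr _ lam_r); split=> //; apply/negP => rS.
  by have [i [mu_i /(no_i i mu_i)]] := slid_diagram_corner lam_ni lam_r slS rS.
by case/(slid_diagram_decr _ lam_r).
Qed.

(** Diagrams are sorted by whether they contain [(r, lam r)]; those that do correspond, by losing
    this cell, to the diagrams of the two smaller shapes. *)
Lemma slid_sum_add i : corner mu i -> mu i + r = i + lam r ->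
  (slid_sum lam mu = slid_sum (decr lam r) mu
     + w (r, lam r) * slid_sum (decr lam r) (decr mu i))%R.
Proof.
move=> mu_i diag; rewrite /slid_sum.
pose add (S : {fset nat * nat}) := (r, lam r) |` S.
have notin mu' S : S \in slid_diagrams d (decr lam r) mu' -> (r, lam r) \notin S.
  by move/(slid_diagramsP _ _ lam'_sh)/(slid_diagram_decr _ lam_r) => [].
rewrite (big_fsetID _ (fun S : {fset nat * nat} => (r, lam r) \notin S)) /=.
have -> : [fset S in slid_diagrams d lam mu | (r, lam r) \notin S] =
    slid_diagrams d (decr lam r) mu.
  apply/fsetP => S; rewrite in_fset /=; apply/andP/(slid_diagramsP _ _ lam'_sh).
    by case=> /(slid_diagramsP _ _ lam_sh) slS nS; apply/(slid_diagram_decr _ lam_r).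
  by case/(slid_diagram_decr _ lam_r) => slS nS; split=> //; apply/(slid_diagramsP _ _ lam_sh).
have -> : [fset S in slid_diagrams d lam mu | ~~ ((r, lam r) \notin S)] =
    [fset add S | S in slid_diagrams d (decr lam r) (decr mu i)].
  apply/fsetP => S; rewrite in_fset; apply/andP/imfsetP => /=.
    case=> /(slid_diagramsP _ _ lam_sh) slS /negPn rS.
    have [i' [mu_i' diag' slS']] := slid_diagram_corner lam_ni lam_r slS rS.
    rewrite (diag_inj mu_ni diag diag').
    exists (S `\ (r, lam r)); last by rewrite /add fsetD1K.
    exact/(slid_diagramsP _ _ lam'_sh).
  case=> S' /(slid_diagramsP _ _ lam'_sh) slS' ->; rewrite /add fset1U1; split=> //.
  by apply/(slid_diagramsP _ _ lam_sh); apply: slid_diagram_add slS'.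
congr (_ + _)%R; rewrite big_imfset /=; last first.
  move=> S S' /notin nS /notin nS' E; apply/fsetP => z; move/fsetP/(_ z): E.
  rewrite !in_fset1U; case: eqVneq => [->|//].
  by rewrite (negbTE nS) (negbTE nS').
rewrite mulr_sumr; apply: eq_big_seq => S /notin nS.
by rewrite big_fsetU1.
Qed.

End GenericSum.

(** * Factorial determinants *)

(** The shifted parts, also known as beta-numbers. *)
Definition pos (d : nat) (mu : nat -> nat) (i : nat) := mu i + (d - i).

Definition column_length (d : nat) (lam : nat -> nat) (j : nat) :=
  \sum_(i < d) (j <= lam i.+1).

Lemma pos_lt d mu i i' : noninc mu -> i < i' <= d -> pos d mu i' < pos d mu i.
Proof. by move=> mu_ni /andP[/[dup] ? /ltnW/(noninc_le mu_ni)]; rewrite /pos; lia. Qed.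

Lemma pos_inj d mu i i' : noninc mu -> i <= d -> i' <= d ->
  pos d mu i = pos d mu i' -> i = i'.
Proof.
move=> mu_ni id id'; case: (ltngtP i i') => // lt_i.
  by have := @pos_lt d mu i i' mu_ni; lia.
by have := @pos_lt d mu i' i mu_ni; lia.
Qed.

Lemma pos_decr d mu r i : corner mu r ->
  pos d (decr mu r) i = if i == r then (pos d mu r).-1 else pos d mu i.
Proof. by rewrite /pos /decr /corner => mu_r; case: eqP => [->|//]; lia. Qed.

Definition transp (p k : nat) := if k == p then p.+1 else if k == p.+1 then p else k.

Lemma swap_id p k : k != p -> k != p.+1 -> transp p k = k.
Proof. by rewrite /transp => /negbTE-> /negbTE->. Qed.

(** Only the prefix of length [p.+1] separates [p] from [p.+1]; any other contains both or
    neither. *)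
Lemma prod_swap (K : comNzRingType) (F : nat -> K) p m : m != p.+1 ->
  (\prod_(k < m) F (transp p k) = \prod_(k < m) F k)%R.
Proof.
move=> mp; have [le_mp|lt_pm] := leqP m p.
  by apply: eq_bigr => -[k /= km] _; rewrite swap_id //; lia.
have {mp} /subnK <- : p.+2 <= m by lia.
elim: (m - p.+2) => [|n IH]; last first.
  rewrite addSn !big_ord_recr /= IH; congr (_ * F _)%R.
  by rewrite swap_id //; lia.
rewrite add0n !big_ord_recr /= mulrAC; congr (_ * F _ * F _)%R.
- by apply: eq_bigr => -[k /= km] _; rewrite swap_id //; lia.
- by rewrite /transp eqxx gtn_eqF.
- by rewrite /transp eqxx.
Qed.

Section Factorial.
Variables (K : comNzRingType) (d N : nat) (x : nat -> K).

(** Up to sign, the determinant is the numerator of a factorial Schur function in the variables [x]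
    with parameters [t]. *)
Definition factorial_mx (t : nat -> K) (mu : nat -> nat) : 'M[K]_d :=
  (\matrix_(i, j) \prod_(k < pos d mu i.+1) (t k - x j.+1))%R.

Variables (t : nat -> K) (mu : nat -> nat) (p : nat).
Hypothesis mu_sh : is_shape d N mu.
Let mu_ni : noninc mu. Proof. by case: mu_sh. Qed.

Lemma det_factorial_swap_id : (forall i, 0 < i <= d -> pos d mu i != p.+1) ->
  (\det (factorial_mx t mu) = \det (factorial_mx (t \o transp p) mu))%R.
Proof.
move=> no_p; congr (\det _)%R; apply/matrixP => i j; rewrite !mxE.
by rewrite (prod_swap (fun k => t k - x j.+1)%R) ?no_p //= ltn_ord.
Qed.

Let replaced_mx (i0 : 'I_d) : 'M[K]_d :=
  (\matrix_(i, j) \prod_(k < if i == i0 then p else pos d mu i.+1)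
     (t (transp p k) - x j.+1))%R.

(** Only row [i0] is affected by the swap, and there only the last of [p.+1] factors changes, by
    [t p - t p.+1] in every column; the rest is linearity in that row. *)
Let det_replaced (i0 : 'I_d) : pos d mu i0.+1 = p.+1 ->
  (\det (factorial_mx t mu) = \det (factorial_mx (t \o transp p) mu)
     + (t p - t p.+1) * \det (replaced_mx i0))%R.
Proof.
move=> posE; have other i : pos d mu (lift i0 i).+1 != p.+1.
  rewrite -posE; apply/eqP => E0; have E : lift i0 i = i0.
    by apply/val_inj/succn_inj; apply: pos_inj E0; rewrite ?ltn_ord.
  by have := neq_lift i0 i; rewrite E eqxx.
rewrite -[X in (_ = X + _)%R]mul1r.
apply: (@determinant_multilinear _ _ _ _ _ i0).
- apply/rowP => j; rewrite !mxE eqxx posE !big_ord_recr /=.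
  rewrite (prod_swap (fun k => t k - x j.+1)%R); last lia.
  by rewrite /transp eqxx; ring.
- apply/matrixP => i j; rewrite !mxE /= (prod_swap (fun k => t k - x j.+1)%R) ?other //.
- apply/matrixP => i j; rewrite !mxE /= eq_sym (negbTE (neq_lift i0 i)).
  rewrite (prod_swap (fun k => t k - x j.+1)%R) ?other //.
Qed.

(** The replaced row has [p] factors, hence is the row of [decr mu i]. *)
Lemma det_factorial_swap_corner i : i <= d -> corner mu i -> pos d mu i = p.+1 ->
  (\det (factorial_mx t mu) = \det (factorial_mx (t \o transp p) mu)
     + (t p - t p.+1) * \det (factorial_mx (t \o transp p) (decr mu i)))%R.
Proof.
case: i => [|i] // lt_id mu_i posE; rewrite (@det_replaced (Ordinal lt_id)) //.
congr (_ + _ * \det _)%R; apply/matrixP => i' j; rewrite !mxE pos_decr //.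
by rewrite eqSS -val_eqE /=; case: eqP; rewrite ?posE.
Qed.

(** The next row has [p] factors as well, so it coincides with the replaced row. *)
Lemma det_factorial_swap_flat i : 0 < i < d -> mu i.+1 = mu i -> pos d mu i = p.+1 ->
  (\det (factorial_mx t mu) = \det (factorial_mx (t \o transp p) mu))%R.
Proof.
case: i => [|i] //= lt_id mu_i posE.
rewrite (@det_replaced (Ordinal (ltnW lt_id))) //.
rewrite (@determinant_alternate _ _ (replaced_mx _) (Ordinal (ltnW lt_id)) (Ordinal lt_id)).
- by rewrite mulr0 addr0.
- by rewrite -val_eqE /= ltn_eqF.
move=> j; rewrite !mxE eqxx -val_eqE /= gtn_eqF //.
by have -> : pos d mu i.+2 = p by move: posE; rewrite /pos mu_i; lia.
Qed.

End Factorial.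

Lemma column_length_le d lam j : column_length d lam j <= d.
Proof.
rewrite /column_length -[leqRHS]card_ord -sum1_card.
by apply: leq_sum => i _; exact: leq_b1.
Qed.

Lemma leq_column_length d lam i j : noninc lam -> 0 < i <= d ->
  (i <= column_length d lam j) = (j <= lam i).
Proof.
move=> lam_ni; elim: d i => [|d IH] i /andP[i0]; first lia.
rewrite leq_eqVlt ltnS {1}/column_length big_ord_recr /= -/(column_length d lam j).
have le_d := column_length_le d lam j; have le_lam := noninc_le lam_ni (leqnSn d).
case/orP=> [/eqP iE|id]; last first.
  by have := noninc_le lam_ni (leqW id); have := IH i; lia.
have [d0|d0] := posnP d; first by move: le_d; rewrite iE d0; lia.
by have := IH d; rewrite iE; lia.
Qed.

Lemma column_length_eq d lam j r : noninc lam -> r <= d ->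
  (forall i, 0 < i <= d -> (j <= lam i) = (i <= r)) -> column_length d lam j = r.
Proof.
move=> lam_ni rd lamE; have := column_length_le d lam j.
case: (ltngtP (column_length d lam j) r) => // [lt|gt] le_d.
  have := @leq_column_length d lam r j lam_ni; rewrite lamE; lia.
have := @leq_column_length d lam (column_length d lam j) j lam_ni; rewrite lamE; lia.
Qed.

Lemma column_length_corner d lam r : noninc lam -> corner lam r -> r <= d ->
  column_length d lam (lam r) = r.
Proof.
move=> lam_ni /andP[r0 lamr] rd; apply: column_length_eq => // i _.
have [/[dup] ? /(noninc_le lam_ni)|/[dup] ? /(noninc_le lam_ni)] := leqP i r; lia.
Qed.

Lemma column_length_decr d lam r j : noninc lam -> corner lam r -> r <= d ->
  column_length d (decr lam r) j =
  if j == lam r then r.-1 else column_length d lam j.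
Proof.
move=> lam_ni lam_r rd; have /andP[r0 lamr] := lam_r.
case: eqP => [->|ne]; last first.
  by apply: eq_bigr => i _; rewrite /decr; case: eqP => [E|//]; rewrite E; lia.
apply: column_length_eq; [exact: noninc_decr|lia|move=> i _; rewrite /decr].
case: eqP => [->|?]; first lia.
have [/[dup] ? /(noninc_le lam_ni)|/[dup] ? /(noninc_le lam_ni)] := leqP i r; lia.
Qed.

Lemma corner_exists d N lam : is_shape d N lam -> 0 < \sum_(i < d) lam i.+1 ->
  exists2 r, r <= d & corner lam r.
Proof.
move=> lam_sh; rewrite lt0n sum_nat_eq0 negb_forall => /existsP[i /= lam_i].
have ex : exists i, (0 < i) && (0 < lam i) by exists i.+1; lia.
have ub k : (0 < k) && (0 < lam k) -> k <= d.
  by have := @shape_out d N lam k lam_sh; lia.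
(* The last nonempty row ends in a corner. *)
case: (ex_maxnP ex ub) => r rP rmax.
exists r; first exact: ub.
by rewrite /corner; have := rmax r.+1; lia.
Qed.

Lemma corner_le d N mu i : is_shape d N mu -> corner mu i -> i <= d.
Proof. by move=> /shape_out mu_out /andP[_]; have := mu_out i; lia. Qed.

(** * The sum over excited diagrams as a factorial determinant *)

Section Localization.
Variables (K : comNzRingType) (d N : nat) (x y : nat -> K).

Definition weight_xy (c : nat * nat) : K := (y c.2 - x c.1)%R.

(* Up to sign the Vandermonde determinant of [x]; only its independence of [lam],
   [mu] and [t] matters. *)
Definition vandermonde_xx : K :=
  (\det (\matrix_(i < d, j < d) \prod_(k < d - i.+1) (x (d - k)%N - x j.+1)))%R.

(** Only an empty [mu] has a diagram in an empty shape. If [mu 1 > 0], the first row of the matrix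
    has at least [d] factors, among them [t (d - j) - x j = 0] in column [j]. *)
Lemma slid_sum_empty lam mu t : is_shape d N lam -> is_shape d N mu ->
  (forall i, 0 < i -> lam i = 0) ->
  (forall i, 0 < i <= d -> t (pos d lam i) = x i) ->
  (slid_sum d weight_xy lam mu * vandermonde_xx = \det (factorial_mx d x t mu))%R.
Proof.
move=> lam_sh mu_sh lam0 tx; have [mu_ni _ mud] := mu_sh.
have {}tx i : 0 < i <= d -> t (d - i) = x i.
  by move=> id; rewrite -tx // /pos lam0 //; lia.
have nolam z : ~~ cell lam z.
  by apply/negP => /and3P[z1 z2]; rewrite lam0 //; lia.
have [mu1|mu1] := posnP (mu 1).
  have mu0 i : 0 < i -> mu i = 0 by move/(noninc_le mu_ni); lia.
  have -> : slid_sum d weight_xy lam mu = 1%R.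
    rewrite /slid_sum; have -> : slid_diagrams d lam mu = [fset fset0].
      apply/fsetP => S; rewrite in_fset1; apply/(slid_diagramsP _ _ lam_sh)/eqP.
        case=> e [_ _ sub]; apply/fsetP => z; rewrite in_fset0; apply/negP => /sub.
        exact/negP/nolam.
      move=> ->; exists (fun=> 0); split=> // z; rewrite in_fset0; split=> // -[c].
      by move=> /and3P[c1 c2]; rewrite mu0 //; lia.
    by rewrite big_seq_fset1 big_seq_fset0.
  rewrite mul1r; congr (\det _)%R; apply/matrixP => i j; rewrite !mxE.
  rewrite /pos mu0 // add0n; apply: eq_bigr => -[k /= kd] _; congr (_ - _)%R.
  by rewrite -tx; [congr t|]; lia.
have -> : slid_sum d weight_xy lam mu = 0%R.
  rewrite /slid_sum; have -> : slid_diagrams d lam mu = fset0.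
    apply/fsetP => S; rewrite in_fset0; apply/negP => /(slid_diagramsP _ _ lam_sh).
    case=> e [_ Se sub]; have c : cell mu (1, 1) by [].
    have : slide e (1, 1) \in S by apply/Se; exists (1, 1).
    by move/sub; exact/negP/nolam.
  by rewrite big_seq_fset0.
have d0 : 0 < d by case: (posnP d) mud => // -> mud; rewrite mud in mu1.
rewrite mul0r (expand_det_row _ (Ordinal d0)) big1 // => j _; rewrite !mxE.
have kP : d - j.+1 < pos d mu 1 by rewrite /pos; lia.
rewrite (bigD1 (Ordinal kP)) //= tx; last by have := ltn_ord j; lia.
by rewrite subrr !mul0r.
Qed.

(* [t] lists the [x i] and the [y j] along the boundary path of [lam]. *)
Theorem slid_sum_det lam mu t : is_shape d N lam -> is_shape d N mu ->
  (forall i, 0 < i <= d -> t (pos d lam i) = x i) ->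
  (forall j, 0 < j <= N -> t (j.-1 + (d - column_length d lam j)) = y j) ->
  (slid_sum d weight_xy lam mu * vandermonde_xx = \det (factorial_mx d x t mu))%R.
Proof.
move En : (\sum_(i < d) lam i.+1) => n.
elim: n => [|n IH] in lam mu t En * => lam_sh mu_sh tx ty.
  apply: (slid_sum_empty lam_sh) => // i i0; have [id|] := leqP i d; last first.
    exact: (shape_out lam_sh).
  move/eqP: En; rewrite sum_nat_eq0 => /forallP; case: i i0 id => // i _ id.
  by move/(_ (Ordinal id)) => /= /eqP.
have [r rd lam_r] : exists2 r, r <= d & corner lam r.
  by apply: (corner_exists lam_sh); rewrite En.
have [lam_ni _ _] := lam_sh; have [mu_ni _ mud] := mu_sh.
have lam'_sh := shape_decr lam_sh lam_r.
have /andP[r0 lamr] := lam_r.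
(* The corner consists of two consecutive boundary steps: [t p] is [y (lam r)] and [t p.+1] is
   [x r], so [t p - t p.+1] is the weight of the corner. *)
pose p := (pos d lam r).-1; have pE : pos d lam r = p.+1 by rewrite /p /pos; lia.
have xr : x r = t p.+1 by rewrite -tx ?pE ?r0.
have colr := column_length_corner lam_ni lam_r rd.
have lamrN := shape_le r lam_sh.
have yr : y (lam r) = t p by rewrite -ty ?colr; [congr t; rewrite /p /pos|]; lia.
have En' : \sum_(i < d) decr lam r i.+1 = n.
  case: (r) r0 rd lamr En => // r1 _ r1d lamr.
  rewrite (bigD1 (Ordinal r1d)) //= => En1; rewrite (bigD1 (Ordinal r1d)) //=.
  rewrite {1}/decr eqxx (eq_bigr (fun i : 'I_d => lam i.+1)); first lia.
  by move=> i; rewrite -val_eqE /decr eqSS => /negbTE->.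
(* The boundary of [decr lam r] has the same steps with those at [p] and [p.+1] exchanged. *)
have tx' i : 0 < i <= d -> (t \o transp p) (pos d (decr lam r) i) = x i.
  move=> id; rewrite pos_decr //=; case: eqP => [->|ne].
    by rewrite pE /transp eqxx xr.
  have le1 : i < r -> p.+1 < pos d lam i by rewrite -pE => ir; apply: (pos_lt lam_ni); lia.
  have le2 : r < i -> pos d lam i < p.
    by move=> /[dup] ? /(noninc_le lam_ni); rewrite /p /pos; lia.
  by rewrite swap_id; [exact: tx|lia..].
have ty' j : 0 < j <= N ->
    (t \o transp p) (j.-1 + (d - column_length d (decr lam r) j)) = y j.
  move=> jN; rewrite /= column_length_decr //; case: eqP => [->|ne].
    have -> : (lam r).-1 + (d - r.-1) = p.+1 by rewrite /p /pos; lia.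
    by rewrite /transp eqxx gtn_eqF // yr.
  have := leq_column_length j lam_ni (i := r) (d := d); rewrite r0 rd => /(_ isT) col.
  have := column_length_le d lam j.
  by rewrite swap_id; [rewrite ty|rewrite /p /pos; lia..].
have IHmu nu : is_shape d N nu -> (slid_sum d weight_xy (decr lam r) nu *
    vandermonde_xx = \det (factorial_mx d x (t \o transp p) nu))%R.
  by move=> nu_sh; apply: IH.
(* The row of the matrix affected by the swap is that of the row of [mu] ending on the diagonal of
   the removed corner. *)
have diag i : i <= d -> pos d mu i = p.+1 <-> mu i + r = i + lam r.
  by rewrite -pE /pos; lia.
have [[i /eqP posi]|no_p] := altP (@existsP _ (fun i : 'I_d => pos d mu i.+1 == p.+1)).
  have [mu_i|] := boolP (corner mu i.+1).
    rewrite (slid_sum_add _ lam_sh mu_sh lam_r mu_i); last by apply/diag.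
    rewrite (det_factorial_swap_corner _ _ mu_sh _ mu_i posi) //.
    rewrite mulrDl -mulrA !IHmu //; last exact: shape_decr.
    by rewrite /weight_xy /= xr yr.
  rewrite negb_and /= => flat; have := mu_ni i.+1 => le_mu.
  (* A flat row is not the last one: [mu d.+1 = 0] would give [mu d = 0] and [pos d mu d = 0], which
     is not [p.+1]. *)
  have id' : i.+1 < d.
    case: (ltngtP i.+1 d) (ltn_ord i) => // iE _.
    by move: posi flat le_mu; rewrite iE mud /pos; lia.
  rewrite (det_factorial_swap_flat _ _ mu_sh _ _ posi) //; last lia.
  rewrite (slid_sum_skip _ lam_sh lam_r) ?IHmu // => i' mu_i' diag'.
  move/diag: posi => /(_ (ltn_ord i)) /(diag_inj mu_ni diag') i'E.
  by move: mu_i' flat; rewrite i'E => /andP[_]; lia.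
rewrite (@det_factorial_swap_id _ _ _ _ _ p).
  rewrite (slid_sum_skip _ lam_sh lam_r) ?IHmu // => i mu_i.
  have id := corner_le mu_sh mu_i; move/(diag i id) => posi.
  case/existsP: no_p; have /andP[i0 _] := mu_i.
  by case: i i0 id posi mu_i => // i _ id posi _; exists (Ordinal id); apply/eqP.
move=> [//|i] /= id; apply: contra no_p => posi.
by apply/existsP; exists (Ordinal id).
Qed.

End Localization.

(** * Specialization at powers of q *)

Lemma det_scale (K : comNzRingType) n (a b : 'I_n -> K) (A : 'M[K]_n) :
  (\det (\matrix_(i, j) (a i * b j * A i j)) = (\prod_i a i) * (\prod_j b j) * \det A)%R.
Proof.
have -> : (\matrix_(i, j) (a i * b j * A i j) =
    diag_mx (\row_i a i) *m A *m diag_mx (\row_j b j))%R.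
  by rewrite mul_diag_mx mul_mx_diag; apply/matrixP => i j; rewrite !mxE mulrAC.
rewrite !det_mulmx !det_diag mulrAC; congr (_ * _ * _)%R;
by apply: eq_bigr => i _; rewrite mxE.
Qed.

Lemma sum_cells d mu (F : nat * nat -> nat) :
  \sum_(c <- cells d mu) F c = \sum_(i < d) \sum_(j < mu i.+1) F (i.+1, j.+1).
Proof.
rewrite /cells big_imfset //= undup_id; last first.
  rewrite allpairs_uniq_dep ?iota_uniq // => [i _|[i j] [i' j'] _ _ [-> ->] //].
  exact: iota_uniq.
rewrite big_allpairs_dep /=.
transitivity (\sum_(1 <= i < d.+1) \sum_(1 <= j < (mu i).+1) F (i, j)).
  rewrite /index_iota subSS subn0; apply: eq_bigr => i _.
  by rewrite subSS subn0.
by rewrite big_add1 big_mkord; apply: eq_bigr => i _; rewrite big_add1 big_mkord.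
Qed.

(** The binomial coefficient [n] choose 2, the exponent of [q] in [prod_qfact]. *)
Definition tri (n : nat) := \sum_(k < n) k.

(* The content of a cell, shifted by [d - 1] so as to be a natural number;
   sliding along the diagonal preserves it. *)
Definition content (d : nat) (c : nat * nat) := c.2.-1 + (d - c.1).

(** For row [i] of [mu], the summands of [tri] from [d - i] on are the contents of the cells of that
    row. *)
Lemma tri_pos d mu :
  \sum_(i < d) tri (pos d mu i.+1) =
  \sum_(c <- cells d mu) content d c + \sum_(i < d) tri (d - i.+1).
Proof.
rewrite sum_cells -big_split /=; apply: eq_bigr => i _.
rewrite /pos addnC /tri big_split_ord /= addnC; congr (_ + _).
by apply: eq_bigr => j _; rewrite /content /= addnC.
Qed.

Lemma sum_content_slid d N lam mu S : is_shape d N lam -> is_shape d N mu ->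
  slid_diagram lam mu S ->
  \sum_(c <- S) content d c = \sum_(c <- cells d mu) content d c.
Proof.
move=> lam_sh mu_sh [e [rppe Se sub]].
have -> : S = [fset slide e c | c in cells d mu].
  apply/fsetP => z; apply/idP/imfsetP => /=.
    by case/Se => c cmu ->; exists c => //; rewrite (mem_shape _ mu_sh).
  by case=> c; rewrite (mem_shape _ mu_sh) => cmu ->; apply/Se; exists c.
rewrite big_imfset /=; last first.
  by move=> c c'; rewrite !(mem_shape _ mu_sh); apply: slide_inj.
apply: eq_big_seq => c; rewrite (mem_shape _ mu_sh) => cmu.
have : slide e c \in S by apply/Se; exists c.
(* The slid cell still has row at most [d], so the truncated difference in [content] is exact. *)
move/sub/(cell_row lam_sh); have /and3P[c1 c2 _] := cmu.
by rewrite /content /slide /=; lia.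
Qed.

(** The end of a row has no room to slide, and it bounds the displacements in its row. *)
Lemma slid_diagrams_self d N lam : is_shape d N lam ->
  slid_diagrams d lam lam = [fset cells d lam].
Proof.
move=> lam_sh; have [lam_ni _ _] := lam_sh.
apply/fsetP => S; rewrite in_fset1; apply/(slid_diagramsP _ _ lam_sh)/eqP => [|->].
  case=> e [rppe Se sub]; have e0 c : cell lam c -> e c = 0.
    case: c => i j ij; have /and3P[/= i0 j0 jlam] := ij.
    have ilam : cell lam (i, lam i) by rewrite /cell /= i0 leqnn; lia.
    have := rppe _ _ ij ilam (leqnn _) jlam.
    have : slide e (i, lam i) \in S by apply/Se; exists (i, lam i).
    by move/sub => /and3P[/= _ _]; have := noninc_le lam_ni (leq_addr (e (i, lam i)) i); lia.
  apply/fsetP => z; rewrite (mem_shape _ lam_sh); apply/idP/idP => [/sub //|zlam].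
  by apply/Se; exists z => //; rewrite /slide e0 // !addn0; case: (z).
exists (fun=> 0); split=> // z; rewrite (mem_shape _ lam_sh) //.
have slide0 c : slide (fun=> 0) c = c by rewrite /slide !addn0; case: c.
by split=> [zlam|[c clam ->]]; [exists z; rewrite ?slide0|rewrite slide0].
Qed.

Lemma slid_diagrams_not_sub d N lam mu i : is_shape d N lam ->
  lam i < mu i -> 0 < i -> slid_diagrams d lam mu = fset0.
Proof.
move=> lam_sh lt_i i0; have [lam_ni _ _] := lam_sh.
apply/fsetP => S; rewrite in_fset0; apply/negP => /(slid_diagramsP _ _ lam_sh).
case=> e [_ Se sub]; have imu : cell mu (i, mu i) by rewrite /cell /= i0; lia.
have : slide e (i, mu i) \in S by apply/Se; exists (i, mu i).
move/sub => /and3P[/= _ _]; have := noninc_le lam_ni (leq_addr (e (i, mu i)) i); lia.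
Qed.

Local Open Scope ring_scope.

Section QSpecialization.
Variable R : comNzRingType.
Local Notation q := (@fpsX R).

Lemma coef_fpsXM k (f : fps R) n : fps_coef (q ^+ k * f) (k + n) = fps_coef f n.
Proof.
elim: k n => [|k IH] n; first by rewrite expr0 mul1r.
have coefX (g : fps R) m : fps_coef (q * g) m.+1 = fps_coef g m.
  rewrite [LHS]/= big_ord_recl mul0r add0r big_ord_recl /= mul1r big1 ?addr0 ?subSS ?subn0 //.
  by move=> i _; rewrite /= mul0r.
by rewrite exprS -mulrA addSn coefX.
Qed.

(** [q] has no inverse, but its powers can still be cancelled. *)
Lemma fpsXn_reg k : GRing.lreg (q ^+ k).
Proof.
move=> f g E; apply/fpsP => n.
by rewrite -(coef_fpsXM k f) -(coef_fpsXM k g) E.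
Qed.

(** The q-Pochhammer symbol [(q; q)_n]. *)
Definition qfact (n : nat) : fps R := \prod_(k < n) (1 - q ^+ k.+1).

Lemma qfact_unit n : qfact n \is a GRing.unit.
Proof. apply: (big_ind (fun f => f \is a GRing.unit)) => [|f g fU gU|i _].
- exact: unitr1.
- by rewrite unitrM fU.
- exact: fps_unit_1subXn.
 Qed.

(* The principal specialization of the complete symmetric function of degree
   [l - m], which vanishes in negative degree. *)
Definition qhom (l m : nat) : fps R := if (m <= l)%N then (qfact (l - m))^-1 else 0.

(** For [k <= l] the factor is [q^k (1 - q^(l - k))]; if [m > l], the factor with [k = l] vanishes,
    in agreement with [qhom l m = 0]. *)
Lemma prod_qfact l m :
  \prod_(k < m) (q ^+ k - q ^+ l) = q ^+ tri m * qfact l * qhom l m.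
Proof.
rewrite /qhom; case: leqP => [le_ml|lt_lm]; last first.
  by rewrite (bigD1 (Ordinal lt_lm)) //= subrr mul0r mulr0.
apply: (canRL (mulrK (qfact_unit _))).
elim: m le_ml => [|m IH] le_ml; first by rewrite /tri !big_ord0 expr0 !mul1r subn0.
rewrite /tri big_ord_recr /= -/(tri m) big_ord_recr /= exprD.
have := IH (ltnW le_ml); have -> : (l - m = (l - m.+1).+1)%N by lia.
rewrite {1}/qfact big_ord_recr -/(qfact _) /= => E.
rewrite [RHS]mulrAC -E; have -> : q ^+ l = q ^+ m * q ^+ (l - m.+1).+1.
  by rewrite -exprD; congr (_ ^+ _); lia.
by ring.
Qed.

(** The Jacobi-Trudi determinant at [1, q, q^2, ...]. *)
Definition qdet (d : nat) (lam mu : nat -> nat) : fps R :=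
  \det (\matrix_(i < d, j < d) qhom (pos d lam j.+1) (pos d mu i.+1)).

Lemma det_factorial_q d lam mu :
  \det (factorial_mx d (fun i => q ^+ pos d lam i) (fun k => q ^+ k) mu) =
  q ^+ (\sum_(i < d) tri (pos d mu i.+1))%N *
    (\prod_(j < d) qfact (pos d lam j.+1)) * qdet d lam mu.
Proof.
rewrite /qdet expr_sum -det_scale; congr (\det _); apply/matrixP => i j.
by rewrite !mxE prod_qfact.
Qed.

Lemma qdet_self d lam : noninc lam -> qdet d lam lam = 1.
Proof.
move=> lam_ni; rewrite /qdet det_trig.
  by apply: big1 => i _; rewrite !mxE /qhom leqnn subnn /qfact big_ord0 invr1.
apply/is_trig_mxP => i j lt_ij; rewrite !mxE /qhom leqNgt.
by rewrite (@pos_lt d lam i.+1 j.+1) // ltnS lt_ij ltn_ord.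
Qed.

End QSpecialization.

Definition hook_length (d : nat) (lam : nat -> nat) (c : nat * nat) : nat :=
  (lam c.1 - c.2 + (column_length d lam c.2 - c.1) + 1)%N.

Lemma big_fset_subset (T : Type) (idx : T) (op : Monoid.com_law idx) (I : choiceType)
    (A B : {fset I}) (F : I -> T) : B `<=` A ->
  \big[op/idx]_(i <- A) F i =
  op (\big[op/idx]_(i <- A `\` B) F i) (\big[op/idx]_(i <- B) F i).
Proof.
move=> sub; rewrite (big_fsetID _ (fun i => i \notin B)) /=.
have -> : [fset i in A | i \notin B] = A `\` B.
  by apply/fsetP => i; rewrite !inE andbC.
have -> // : [fset i in A | ~~ (i \notin B)] = B.
apply/fsetP => i; rewrite in_fset; apply/andP/idP => /= [[_ /negPn]//|iB].
by rewrite (fsubsetP sub) // iB.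
Qed.

(** * The determinant as a sum over excited diagrams with hook weights *)

Section HookFormula.
Variables (R : comNzRingType) (d N : nat) (lam : nat -> nat).
Hypothesis lam_sh : is_shape d N lam.
Local Notation q := (@fpsX R).

Let lam_ni : noninc lam. Proof. by case: lam_sh. Qed.

Let ypos (j : nat) := (j.-1 + (d - column_length d lam j))%N.
Let w := weight_xy (fun i => q ^+ pos d lam i) (fun j => q ^+ ypos j).
Let exp_det (mu : nat -> nat) := (\sum_(i < d) tri (pos d mu i.+1))%N.
Let G := slid_sum d w lam.

Let G_det mu : is_shape d N mu ->
  G mu * vandermonde_xx d (fun i => q ^+ pos d lam i) =
  q ^+ exp_det mu * (\prod_(j < d) qfact R (pos d lam j.+1)) * qdet R d lam mu.
Proof.
by move=> mu_sh; rewrite -det_factorial_q; apply: (slid_sum_det lam_sh mu_sh).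
Qed.

Let G_qdet mu : is_shape d N mu ->
  q ^+ exp_det lam * G mu = q ^+ exp_det mu * qdet R d lam mu * G lam.
Proof.
move=> mu_sh; have := G_det lam_sh; rewrite qdet_self // mulr1 => Glam.
have Gmu := G_det mu_sh; set A := \prod_(j < d) _ in Glam Gmu.
have A_unit : A \is a GRing.unit.
  apply: (big_ind (fun f => f \is a GRing.unit)) => [|f g fU gU|i _].
  - exact: unitr1.
  - by rewrite unitrM fU.
  - exact: qfact_unit.
(* The case [mu = lam] replaces [A], and the Vandermonde factor it brings in is absorbed by the case
   of [mu]; it is never divided by. *)
apply: (mulrI A_unit); rewrite mulrA [A * _]mulrC -Glam.
transitivity (G lam * (G mu * vandermonde_xx d (fun i => q ^+ pos d lam i))); first by ring.
by rewrite Gmu; ring.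
Qed.

Let cell_col (c : nat * nat) : c \in cells d lam ->
  [&& 0 < c.1, 0 < c.2, c.2 <= lam c.1, c.1 <= column_length d lam c.2,
      c.1 <= d & column_length d lam c.2 <= d]%N.
Proof.
rewrite mem_cells => /andP[c1d /and3P[c1 c2 clam]].
by rewrite c1 c2 clam leq_column_length // ?c1 // c1d clam column_length_le.
Qed.

(** The hook length of a cell is the distance along the boundary of [lam] between the step of its
    column and the step of its row. *)
Let wE (c : nat * nat) : c \in cells d lam -> w c = q ^+ ypos c.2 * (1 - q ^+ hook_length d lam c).
Proof.
move/cell_col=> hc; rewrite /w /weight_xy mulrBr mulr1 -exprD.
by congr (_ - _ ^+ _); move: hc; rewrite /ypos /hook_length /pos; lia.
Qed.

Let contentE (c : nat * nat) : c \in cells d lam ->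
  (column_length d lam c.2 - c.1 + ypos c.2 = content d c)%N.
Proof. by move/cell_col; rewrite /content /ypos; lia. Qed.

Let hook_unit c : 1 - q ^+ hook_length d lam c \is a GRing.unit.
Proof. by apply: fps_unit_1subXn; rewrite /hook_length addn1. Qed.

Let G_lam : G lam = \prod_(c <- cells d lam) w c.
Proof. by rewrite /G /slid_sum (slid_diagrams_self lam_sh) big_seq_fset1. Qed.

Let G_lam_reg : GRing.lreg (G lam).
Proof.
rewrite G_lam big_seq; apply: (big_ind (@GRing.lreg _)) => [|f g|c clam].
- exact: lreg1.
- exact: lregM.
rewrite wE //; apply: lregM; first exact: fpsXn_reg.
exact: mulrI.
Qed.

(** Read off from the excited side: there is no diagram, so [G mu = 0], and the other factors can be
    cancelled. *)
Lemma qdet_not_sub mu i : is_shape d N mu -> (0 < i)%N -> (lam i < mu i)%N ->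
  qdet R d lam mu = 0.
Proof.
move=> mu_sh i0 lt_i; have := G_qdet mu_sh.
rewrite {1}/G /slid_sum (slid_diagrams_not_sub lam_sh lt_i i0) big_seq_fset0 mulr0.
rewrite mulrAC [X in X * _]mulrC -mulrA => /esym E0.
apply: (@fpsXn_reg R (exp_det mu)); apply: G_lam_reg.
by rewrite E0 !mulr0.
Qed.

Theorem qdet_hook mu : is_shape d N mu ->
  qdet R d lam mu = \sum_(S <- slid_diagrams d lam mu)
    \prod_(c <- cells d lam `\` S)
      (q ^+ (column_length d lam c.2 - c.1)%N / (1 - q ^+ hook_length d lam c)).
Proof.
move=> mu_sh; apply: (@fpsXn_reg R (exp_det mu)); apply: G_lam_reg => /=.
rewrite mulrC -G_qdet // /G /slid_sum !mulr_sumr; apply: eq_big_seq => S.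
move/(slid_diagramsP _ _ lam_sh) => slS; rewrite -/(slid_sum d w lam lam) -/(G lam) G_lam.
have S_sub : S `<=` cells d lam.
  by apply/fsubsetP => z; rewrite (mem_shape _ lam_sh); case: slS => e [_ _]; apply.
rewrite (big_fset_subset _ _ S_sub) /= -mulrA [_ * (_ * _)]mulrCA mulrA [RHS]mulrC mulrA.
rewrite [RHS]mulrAC; congr (_ * _); rewrite -mulrA -big_split /=.
(* The cells in [S] have the same weights on both sides; outside [S] the hook denominator cancels
   against [w c], leaving a power of [q]. *)
have -> : \prod_(c <- cells d lam `\` S)
    (q ^+ (column_length d lam c.2 - c.1) / (1 - q ^+ hook_length d lam c) * w c) =
    \prod_(c <- cells d lam `\` S) q ^+ content d c.
  apply: eq_big_seq => c; rewrite in_fsetD => /andP[_ clam]; rewrite wE //.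
  by rewrite mulrCA divrK // mulrC -exprD contentE.
rewrite -expr_sum -exprD; congr (_ ^+ _).
(* Sliding preserves contents, so [exp_det lam] exceeds [exp_det mu] by the total content outside
   [S]. *)
rewrite /exp_det !tri_pos -(sum_content_slid lam_sh mu_sh slS).
by rewrite (big_fset_subset _ _ S_sub) /=; ring.
Qed.

End HookFormula.

(** * The recurrence over horizontal strips *)

(** Multilinearity: [f] records the summand chosen in each row. *)
Lemma det_sum_rows (K : comNzRingType) n (T : finType) (P : 'I_n -> pred T)
    (F : 'I_n -> T -> 'I_n -> K) :
  \det (\matrix_(i, j) \sum_(v | P i v) F i v j) =
  \sum_(f : {ffun 'I_n -> T} | f \in family P) \det (\matrix_(i, j) F i (f i) j).
Proof.
rewrite /determinant exchange_big /=; apply: eq_bigr => s _.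
rewrite -mulr_sumr; congr (_ * _).
under eq_bigr => i _ do rewrite mxE.
rewrite bigA_distr_big_dep; apply: eq_bigr => f _.
by apply: eq_bigr => i _; rewrite mxE.
Qed.

Section Interlacing.
Variables (d N : nat).
Implicit Type nu : {ffun 'I_d -> 'I_N.+1}.

(** Encoding [nu] as a finite function makes the sums over it finite; the values at 0 and beyond [d]
    follow the convention of [is_shape]. *)
Definition shape_of nu (i : nat) : nat :=
  if i is i'.+1 then (if insub i' is Some k then nu k : nat else 0) else N.

Lemma shape_ofE nu (i : 'I_d) : shape_of nu i.+1 = nu i.
Proof. by rewrite /shape_of valK. Qed.

Lemma shape_of_out nu i : (d < i)%N -> shape_of nu i = 0%N.
Proof. by case: i => // i id; rewrite /shape_of insubF // ltnNge -ltnS id. Qed.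

(** The horizontal strip condition; [nu i] is part number [i.+1], so for the first part the upper
    bound is [mu 0]. *)
Definition interlace (mu : nat -> nat) nu :=
  [forall i : 'I_d, (mu i.+1 <= nu i <= mu i)%N].

Definition contained (lam : nat -> nat) nu := [forall i : 'I_d, (nu i <= lam i.+1)%N].

Lemma shape_of_is_shape mu nu : interlace mu nu -> is_shape d N (shape_of nu).
Proof.
move/forallP => inter; split=> //; last by rewrite shape_of_out.
move=> i; have [lt_id|le_di] := ltnP i d; last by rewrite shape_of_out.
rewrite (shape_ofE nu (Ordinal lt_id)); case: i lt_id => [|i] lt_id.
  by rewrite -ltnS ltn_ord.
have /andP[_ le1] := inter (Ordinal lt_id); apply: leq_trans le1 _.
by rewrite (shape_ofE nu (Ordinal (ltnW lt_id))); have /andP[] := inter (Ordinal (ltnW lt_id)).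
Qed.

Section QDetRec.
Variables (R : comNzRingType) (lam mu : nat -> nat).
Hypotheses (lam_sh : is_shape d N lam) (mu_sh : is_shape d N mu).
Local Notation q := (@fpsX R).

(** This is [h_(m-1) = (1 - q^m) h_m] for [m = l - n]; for [n >= l] both sides vanish. *)
Lemma qhomS l n : qhom R l n.+1 = (1 - q ^+ (l - n)) * qhom R l n.
Proof.
rewrite /qhom; case: ltngtP => [lt_nl|lt_ln|->]; last by rewrite subnn expr0 subrr mul0r.
  have -> : (l - n = (l - n.+1).+1)%N by lia.
  rewrite {2}/qfact big_ord_recr /= -/(qfact _ _).
  by rewrite invrM ?qfact_unit ?fps_unit_1subXn // mulVKr // fps_unit_1subXn.
by rewrite mulr0.
Qed.

Lemma qhom_telescope l a m M : (m <= M)%N ->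
  \sum_(m <= v < M) q ^+ (l - (v + a)) * qhom R l (v + a) =
  qhom R l (m + a) - qhom R l (M + a).
Proof.
move=> le_mM; rewrite -[RHS]opprB -(telescope_sumr (fun v => qhom R l (v + a))) //.
rewrite -sumrN; apply: eq_bigr => v _; rewrite addSn qhomS; ring.
Qed.

Let row_sum (i j : 'I_d) :
  \sum_(v < N.+1 | (mu i.+1 <= v <= mu i)%N)
    q ^+ (pos d lam j.+1 - (v + (d - i.+1))) * qhom R (pos d lam j.+1) (v + (d - i.+1))
  = qhom R (pos d lam j.+1) (pos d mu i.+1) - qhom R (pos d lam j.+1) (pos d mu i).
Proof.
have [mu_ni _ _] := mu_sh; have mu_i := mu_ni i; have muN := shape_le i mu_sh.
have -> : pos d mu i = ((mu i).+1 + (d - i.+1))%N by rewrite /pos; have := ltn_ord i; lia.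
rewrite -qhom_telescope ?leqW // (big_nat_widen _ _ N.+1) // (big_nat_widenl _ 0) //.
by rewrite big_mkord; apply: eq_bigl => v; rewrite ltnS andbC.
Qed.

(** Left multiplication by it subtracts from each row the preceding one. *)
Let diff_mx : 'M[fps R]_d := \matrix_(i, j) ((i == j)%:R - (i == j.+1 :> nat)%:R).

Let det_diff_mx : \det diff_mx = 1.
Proof.
rewrite det_trig; first by apply: big1 => i _; rewrite mxE eqxx ltn_eqF ?subr0.
apply/is_trig_mxP => i j lt_ij; rewrite mxE -val_eqE !ltn_eqF ?subr0 //.
exact: ltnW.
Qed.

Let det_rows : qdet R d lam mu = \det (\matrix_(i < d, j < d)
  \sum_(v < N.+1 | (mu i.+1 <= v <= mu i)%N)
    q ^+ (pos d lam j.+1 - (v + (d - i.+1))) * qhom R (pos d lam j.+1) (v + (d - i.+1))).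
Proof.
rewrite -[LHS]mul1r -det_diff_mx -det_mulmx; congr (\det _); apply/matrixP => i j.
rewrite !mxE row_sum; under eq_bigr => k _ do rewrite !mxE mulrBl.
rewrite sumrB (bigD1 i) //= eqxx mul1r big1 ?addr0 => [|k]; last first.
  by rewrite eq_sym => /negbTE->; rewrite mul0r.
(* Row 0 has no predecessor, and the term to be subtracted is 0: [pos d mu 0 = N + d] exceeds every
   [pos d lam j.+1]. *)
congr (_ - _); case: (posnP i) => [i0|].
  rewrite big1 => [|k _]; last by rewrite i0 mul0r.
  have [_ mu0 _] := mu_sh; have := shape_le j.+1 lam_sh.
  move=> lamN; have lt_pos : (pos d lam j.+1 < pos d mu 0)%N.
    by rewrite /pos mu0; have := ltn_ord j; lia.
  by rewrite i0 /qhom leqNgt lt_pos.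
case: i => [[//|i] id] /= _; rewrite (bigD1 (Ordinal (ltnW id))) //= eqxx mul1r.
rewrite big1 ?addr0 // => k; rewrite -val_eqE /= eqSS eq_sym => /negbTE->.
by rewrite mul0r.
Qed.

(** Multiplying row [i] by [q^(n_i)], with [n_i] the shifted part of [nu], turns the power of [q] in
    each nonzero entry into [q^(l_j)], which comes out of column [j]. *)
Let det_term nu : interlace mu nu ->
  \det (\matrix_(i < d, j < d) (q ^+ (pos d lam j.+1 - (nu i + (d - i.+1))) *
     qhom R (pos d lam j.+1) (nu i + (d - i.+1)))) =
  if contained lam nu then q ^+ (\sum_(i < d) (lam i.+1 - nu i)) *
    qdet R d lam (shape_of nu) else 0.
Proof.
move=> inter; have nu_sh := shape_of_is_shape inter.
apply: (@fpsXn_reg R (\sum_(i < d) pos d (shape_of nu) i.+1)).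
transitivity (q ^+ (\sum_(j < d) pos d lam j.+1) * qdet R d lam (shape_of nu)).
  have scale_row a (A : 'M[fps R]_d) :
      (\prod_i a i) * \det A = \det (\matrix_(i, j) (a i * 1 * A i j)).
    by rewrite (det_scale a (fun=> 1)) big1_eq mulr1.
  have scale_col a (A : 'M[fps R]_d) :
      (\prod_i a i) * \det A = \det (\matrix_(i, j) (1 * a j * A i j)).
    by rewrite (det_scale (fun=> 1)) big1_eq mul1r.
  rewrite !expr_sum scale_row scale_col; congr (\det _); apply/matrixP => i j; rewrite !mxE.
  rewrite mulr1 mul1r /pos shape_ofE mulrA -exprD /qhom.
  case: leqP => [le|_]; last by rewrite !mulr0.
  by congr (_ ^+ _ * _); lia.
case: ifPn => [/forallP sub|].
  rewrite mulrA -exprD -big_split /=; congr (_ ^+ _ * _).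
  by apply: eq_bigr => i _; rewrite /pos shape_ofE; have := sub i; lia.
rewrite negb_forall => /existsP[i]; rewrite -ltnNge -shape_ofE => lt_i.
by rewrite (qdet_not_sub _ lam_sh nu_sh _ lt_i) // !mulr0.
Qed.

Theorem qdet_rec : qdet R d lam mu =
  \sum_(nu : {ffun 'I_d -> 'I_N.+1} | interlace mu nu && contained lam nu)
    q ^+ (\sum_(i < d) (lam i.+1 - nu i)) * qdet R d lam (shape_of nu).
Proof.
rewrite det_rows (det_sum_rows (fun (i : 'I_d) (v : 'I_N.+1) => (mu i.+1 <= v <= mu i)%N)
  (fun (i : 'I_d) (v : 'I_N.+1) (j : 'I_d) => q ^+ (pos d lam j.+1 - (v + (d - i.+1))) *
     qhom R (pos d lam j.+1) (v + (d - i.+1)))).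
rewrite big_mkcondr /=; apply: eq_big => [nu|nu inter].
  by apply/familyP/forallP.
by rewrite det_term //; apply/forallP => i; have /familyP/(_ i) := inter.
Qed.

End QDetRec.
End Interlacing.

(** * Tableaux with bounded entries *)

Local Open Scope nat_scope.

Section BoundedTableaux.
Variables (d N B : nat) (lam : nat -> nat).
Hypotheses (lam_sh : is_shape d N lam).
Local Notation Y := (cells d lam).
Implicit Types (mu : nat -> nat) (T : {ffun Y -> 'I_B.+1}) (c : Y).

Definition rowc c := (val c).1.
Definition colc c := (val c).2.
Definition inner mu c := colc c <= mu (rowc c).

(* Entries vanish on [mu], so that all shapes share one type of fillings. *)
Definition tableau mu (b : nat) T :=
  [&& [forall c, if inner mu c then T c == 0 :> nat else T c < b],
      [forall c, forall c', [&& ~~ inner mu c, rowc c == rowc c' & colc c <= colc c'] ==>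
         (T c <= T c')] &
      [forall c, forall c', [&& ~~ inner mu c, colc c == colc c' & rowc c < rowc c'] ==>
         (T c < T c')]].

Lemma tableauP mu b T :
  reflect [/\ forall c, inner mu c -> T c = 0 :> nat,
              forall c, ~~ inner mu c -> T c < b,
              forall c c', ~~ inner mu c -> rowc c = rowc c' -> colc c <= colc c' -> T c <= T c' &
              forall c c', ~~ inner mu c -> colc c = colc c' -> rowc c < rowc c' -> T c < T c']
          (tableau mu b T).
Proof.
apply: (iffP and3P) => [[/forallP h1 /forallP h2 /forallP h3]|[h0 h1 h2 h3]].
  split=> [c|c|c c'|c c'].
  - by have := h1 c; case: ifP => // _ /eqP.
  - by have := h1 c; case: ifP.
  - have /forallP/(_ c')/implyP h := h2 c; move=> a1 a2 a3; apply: h.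
    by rewrite a1 a2 eqxx.
  - have /forallP/(_ c')/implyP h := h3 c; move=> a1 a2 a3; apply: h.
    by rewrite a1 a2 eqxx.
split; apply/forallP => c.
- by case: ifPn => [/h0->|/h1].
- by apply/forallP => c'; apply/implyP => /and3P[a1 /eqP a2 a3]; exact: h2.
- by apply/forallP => c'; apply/implyP => /and3P[a1 /eqP a2 a3]; exact: h3.
Qed.

Lemma cellP c : [&& 0 < rowc c, rowc c <= d, 0 < colc c & colc c <= lam (rowc c)].
Proof. by have := valP c; rewrite mem_cells => /andP[-> /and3P[-> -> ->]]. Qed.

Lemma cell_ex i j : 0 < i -> 0 < j -> j <= lam i -> exists c, rowc c = i /\ colc c = j.
Proof.
move=> i0 j0 jlam; have ijY : (i, j) \in Y by rewrite (mem_shape _ lam_sh) /cell /= i0 j0.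
by exists [` ijY].
Qed.

Implicit Type nu : {ffun 'I_d -> 'I_N.+1}.

(** Since [mu] is filled with 0, the last zero of each row delimits [mu] together with the zeros of
    the tableau; a row without zeros gets 0. *)
Definition zero_shape T : {ffun 'I_d -> 'I_N.+1} :=
  [ffun i : 'I_d => inord (\max_(c : Y | (rowc c == i.+1) && (T c == 0 :> nat)) colc c)].

Lemma zero_shapeE T (i : 'I_d) :
  zero_shape T i = \max_(c : Y | (rowc c == i.+1) && (T c == 0 :> nat)) colc c :> nat.
Proof.
rewrite ffunE inordK // ltnS; apply/bigmax_leqP => c _.
have /and4P[_ _ _ clam] := cellP c; apply: leq_trans clam _; exact: shape_le lam_sh.
Qed.

(** Rows increase weakly, so the zeros of a row form an initial segment. *)
Lemma zero_shapeP mu b T c : tableau mu b T ->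
  (T c == 0 :> nat) = inner (shape_of (zero_shape T)) c.
Proof.
case/tableauP=> T0 _ Trow _; have /and4P[r0 rd c0 _] := cellP c.
have rowE : rowc c = (rowc c).-1.+1 by lia.
have rd' : (rowc c).-1 < d by lia.
rewrite /inner rowE (shape_ofE _ (Ordinal rd')) zero_shapeE /= -rowE.
apply/idP/idP => [Tc|]; first by apply: leq_bigmax_cond; rewrite eqxx.
move=> le_c; have [/T0->//|nmu] := boolP (inner mu c).
have [c' /andP[/eqP rc' /eqP Tc'] le_c'] :
    exists2 c', (rowc c' == rowc c) && (T c' == 0 :> nat) & colc c <= colc c'.
  apply/exists_inP; apply: contraLR le_c; rewrite negb_exists_in => /forall_inP no.
  rewrite -ltnNge -[X in _ < X]prednK // ltnS; apply/bigmax_leqP => c' /no; lia.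
by have := Trow c c' nmu (esym rc') le_c'; rewrite Tc'; lia.
Qed.

Lemma contained_eq nu nu' : contained lam nu -> contained lam nu' ->
  (forall c, inner (shape_of nu) c = inner (shape_of nu') c) -> nu = nu'.
Proof.
move=> /forallP sub /forallP sub' E; apply/ffunP => i; apply: val_inj => /=.
have le (nu1 nu2 : {ffun 'I_d -> 'I_N.+1}) : nu1 i <= lam i.+1 ->
    (forall c, inner (shape_of nu1) c -> inner (shape_of nu2) c) -> nu1 i <= nu2 i.
  move=> sub1 h; have [->//|nu10] := posnP (nu1 i).
  have [c [rc cc]] := cell_ex (ltn0Sn i) nu10 sub1.
  by have := h c; rewrite /inner rc cc !shape_ofE; apply.
by apply/eqP; rewrite eqn_leq !le // => c; rewrite E.
Qed.

Lemma zero_shape_contained T : contained lam (zero_shape T).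
Proof.
apply/forallP => i; rewrite zero_shapeE; apply/bigmax_leqP => c /andP[/eqP <- _].
by have /and4P[] := cellP c.
Qed.

(** A zero of row [i.+1] beyond column [mu i] would have an entry of the skew shape above it,
    contradicting strictness of the column. *)
Lemma zero_shape_interlace mu b T : is_shape d N mu -> (forall i, mu i <= lam i) ->
  tableau mu b T -> interlace mu (zero_shape T).
Proof.
move=> mu_sh mu_lam tT; have /tableauP[T0 _ _ Tcol] := tT; have [mu_ni mu0 _] := mu_sh.
apply/forallP => i; apply/andP; split.
  have [->//|mui0] := posnP (mu i.+1).
  have [c [rc cc]] := cell_ex (ltn0Sn i) mui0 (mu_lam _).
  have cmu : inner mu c by rewrite /inner rc cc.
  by move: (zero_shapeP c tT); rewrite (T0 c cmu) /inner rc shape_ofE cc => <-.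
rewrite leqNgt; apply/negP => lt_i; case: (posnP i) => [i0|i0].
  by move: lt_i; rewrite i0 mu0; have := ltn_ord (zero_shape T i); lia.
have z0 : 0 < zero_shape T i by lia.
have zlam : zero_shape T i <= lam i.+1 by have /forallP/(_ i) := zero_shape_contained T.
have [c [rc cc]] := cell_ex (ltn0Sn i) z0 zlam.
have [lam_ni _ _] := lam_sh.
have [c' [rc' cc']] := cell_ex i0 z0 (leq_trans zlam (lam_ni i)).
have : T c == 0 :> nat by rewrite (zero_shapeP c tT) /inner rc shape_ofE cc.
have := Tcol c' c; rewrite rc rc' cc cc' /inner rc' cc' -ltnNge lt_i => /(_ isT erefl (ltnSn _)).
by lia.
Qed.

Lemma tableau_shift mu nu b T T' : interlace mu nu ->
  (forall c, T' c = (T c).-1 :> nat) ->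
  (forall c, (T c == 0 :> nat) = inner (shape_of nu) c) ->
  tableau mu b.+1 T = tableau (shape_of nu) b T'.
Proof.
move=> inter T'E Tnu; have inter' : forall i, 0 < i <= d -> mu i <= shape_of nu i <= mu i.-1.
  move=> [//|i] id; rewrite (shape_ofE nu (Ordinal (id : i < d))) /=.
  by have /forallP/(_ (Ordinal id)) := inter.
have munu c : inner mu c -> inner (shape_of nu) c.
  rewrite /inner; have /and4P[r0 rd _ _] := cellP c; have := inter' (rowc c); lia.
have nu_ni : noninc (shape_of nu) by have [] := shape_of_is_shape inter.
have nu_out c c' : ~~ inner (shape_of nu) c -> rowc c <= rowc c' -> colc c <= colc c' ->
    ~~ inner (shape_of nu) c'.
  by rewrite /inner -!ltnNge => ? /(noninc_le nu_ni); lia.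
apply/tableauP/tableauP => -[h0 h1 h2 h3]; split=> [c|c|c c'|c c'].
- by rewrite T'E -Tnu => /eqP->.
- move=> nc; have := h1 c (contra (@munu c) nc); rewrite T'E.
  by move: nc; rewrite -Tnu; lia.
- move=> nc rE le_c; have := h2 c c' (contra (@munu c) nc) rE le_c; rewrite !T'E; lia.
- move=> nc cE lt_r; have := h3 c c' (contra (@munu c) nc) cE lt_r; rewrite !T'E.
  by move: nc; rewrite -Tnu; lia.
- by move/munu; rewrite -Tnu => /eqP.
- move=> _; have [nc|nc] := boolP (inner (shape_of nu) c).
    by move: nc; rewrite -Tnu => /eqP->.
  by have := h1 c nc; rewrite T'E; lia.
- move=> _ rE le_c; have [|nc] := boolP (inner (shape_of nu) c).
    by rewrite -Tnu => /eqP->.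
  have := h2 c c' nc rE le_c; have := nu_out c c' nc; rewrite rE leqnn le_c.
  by move=> /(_ isT isT); rewrite -Tnu !T'E; lia.
- move=> nmu cE lt_r.
  (* Interlacing: below a cell outside [mu] every cell is outside [nu], so a zero is never followed
     by another zero in its column. *)
  have nc' : ~~ inner (shape_of nu) c'.
    have /and4P[r0 rd c0 _] := cellP c; have /and4P[r0' rd' c0' _] := cellP c'.
    have := noninc_le nu_ni lt_r; have := inter' (rowc c).+1.
    by move: nmu; rewrite /inner cE /=; lia.
  have [|nc] := boolP (inner (shape_of nu) c); first by move: nc'; rewrite -!Tnu; lia.
  have := h3 c c' nc cE lt_r; rewrite !T'E; move: nc'; rewrite -Tnu; lia.
Qed.

End BoundedTableaux.

Lemma sum_leq_ord l v : \sum_(j < l) (v <= j) = l - v.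
Proof. by elim: l => [|l IH]; rewrite ?big_ord0 // big_ord_recr /= IH; lia. Qed.

(** * Generating functions of bounded tableaux and their recurrence *)

Section GeneratingFunction.
Variables (R : comNzRingType) (d N B : nat) (lam : nat -> nat).
Hypotheses (lam_sh : is_shape d N lam).
Local Notation Y := (cells d lam).
Local Notation q := (@fpsX R).
Implicit Types (mu : nat -> nat) (T : {ffun Y -> 'I_B.+1}) (c : Y).
Implicit Type nu : {ffun 'I_d -> 'I_N.+1}.

Definition total T := \sum_(c : Y) T c.

Definition tableau_gf (b : nat) mu : fps R :=
  (\sum_(T : {ffun Y -> 'I_B.+1} | tableau mu b T) q ^+ total T)%R.

Lemma sum_outside nu :
  \sum_(c : Y) ~~ inner (shape_of nu) c = \sum_(i < d) (lam i.+1 - nu i).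
Proof.
transitivity (\sum_(c <- Y) ~~ (c.2 <= shape_of nu c.1)).
  by rewrite big_seq_fsetE.
rewrite sum_cells; apply: eq_bigr => i _; rewrite -sum_leq_ord.
by apply: eq_bigr => j _; rewrite shape_ofE -ltnNge ltnS.
Qed.

Definition strip T : {ffun Y -> 'I_B.+1} := [ffun c => inord (T c).-1].

Definition unstrip nu T : {ffun Y -> 'I_B.+1} :=
  [ffun c => if inner (shape_of nu) c then ord0 else inord (T c).+1].

Lemma stripE T c : strip T c = (T c).-1 :> nat.
Proof. by rewrite ffunE inordK //; have := ltn_ord (T c); lia. Qed.

Lemma unstrip_strip nu T : (forall c, (T c == 0 :> nat) = inner (shape_of nu) c) ->
  unstrip nu (strip T) = T.
Proof.
move=> Tnu; apply/ffunP => c; apply: val_inj; rewrite ffunE /= -Tnu.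
case: eqP => [->//|T0]; rewrite stripE prednK ?inord_val //; lia.
Qed.

Lemma unstripE nu T c : (~~ inner (shape_of nu) c -> T c < B) ->
  unstrip nu T c = (if inner (shape_of nu) c then 0 else (T c).+1) :> nat.
Proof. by move=> TB; rewrite ffunE; case: ifPn => // /TB Tc; rewrite inordK. Qed.

(** Stripping is a bijection onto the tableaux on [nu] with entries below [b]; it lowers by one each
    entry outside [nu]. *)
Lemma tableau_gf_fiber mu nu b : b <= B -> is_shape d N mu -> (forall i, mu i <= lam i) ->
  interlace mu nu -> contained lam nu ->
  (\sum_(T : {ffun Y -> 'I_B.+1} | tableau mu b.+1 T && (zero_shape N T == nu))
      q ^+ total T =
   q ^+ (\sum_(i < d) (lam i.+1 - nu i))%N * tableau_gf b (shape_of nu))%R.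
Proof.
move=> bB mu_sh mu_lam inter sub.
have zeroE T : tableau mu b.+1 T && (zero_shape N T == nu) ->
    forall c, (T c == 0 :> nat) = inner (shape_of nu) c.
  by case/andP => tT /eqP <- c; exact: zero_shapeP tT.
rewrite (reindex_onto (unstrip nu) strip) /=; last first.
  by move=> T /zeroE; apply: unstrip_strip.
have condE T : [&& tableau mu b.+1 (unstrip nu T), zero_shape N (unstrip nu T) == nu
     & strip (unstrip nu T) == T] = tableau (shape_of nu) b T.
  apply/idP/idP => [/and3P[h1 h2 /eqP h3]|tT].
    rewrite -(tableau_shift (T := unstrip nu T) _ inter) // => [c|].
      by rewrite -{1}h3 stripE.
    by apply: zeroE; rewrite h1.
  have /tableauP[T0 Tb _ _] := tT.
  have TB c : ~~ inner (shape_of nu) c -> T c < B by move/Tb; lia.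
  have stripU c : T c = (unstrip nu T c).-1 :> nat.
    by rewrite (unstripE (@TB c)); case: ifP => // /T0 ->.
  have unstrip0 c : (unstrip nu T c == 0 :> nat) = inner (shape_of nu) c.
    by rewrite (unstripE (@TB c)); case: ifP.
  have tU : tableau mu b.+1 (unstrip nu T) by rewrite (tableau_shift _ inter stripU).
  rewrite tU /=; apply/andP; split.
    apply/eqP/(contained_eq lam_sh); [exact: zero_shape_contained|by []|].
    by move=> c; rewrite -(zero_shapeP lam_sh c tU).
  by apply/eqP/ffunP => c; apply: val_inj; rewrite /= stripE -stripU.
rewrite /tableau_gf mulr_sumr; apply: eq_big => [T|T]; first by rewrite -condE andbA.
rewrite -andbA condE => tT; have /tableauP[T0 Tb _ _] := tT.
rewrite -exprD; congr (_ ^+ _)%R; rewrite -sum_outside /total -big_split /=.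
apply: eq_bigr => c _; rewrite ffunE.
case: ifPn => [/T0->//|/Tb Tc]; rewrite inordK //; lia.
Qed.

Lemma tableau_gf_rec mu b : b <= B -> is_shape d N mu -> (forall i, mu i <= lam i) ->
  tableau_gf b.+1 mu =
  (\sum_(nu : {ffun 'I_d -> 'I_N.+1} | interlace mu nu && contained lam nu)
    q ^+ (\sum_(i < d) (lam i.+1 - nu i))%N * tableau_gf b (shape_of nu))%R.
Proof.
move=> bB mu_sh mu_lam; rewrite /tableau_gf.
rewrite (partition_big (fun T => zero_shape N T)
  (fun nu => interlace mu nu && contained lam nu)) /= => [|T tT].
  by apply: eq_bigr => nu /andP[inter sub]; apply: tableau_gf_fiber.
by rewrite (zero_shape_interlace lam_sh mu_sh mu_lam tT) zero_shape_contained.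
Qed.

Lemma coef_fpsXM_low k (f : fps R) n : n < k -> fps_coef (q ^+ k * f)%R n = 0%R.
Proof.
move=> lt_nk; rewrite [LHS]/=; apply: big1 => i _; rewrite coef_fpsXn.
by rewrite ltn_eqF ?mul0r //; have := ltn_ord i; lia.
Qed.

Lemma fps_coef_sum (I : Type) (r : seq I) (P : pred I) (F : I -> fps R) n :
  fps_coef (\sum_(i <- r | P i) F i)%R n = (\sum_(i <- r | P i) fps_coef (F i) n)%R.
Proof. by elim/big_rec2: _ => // i y x _ <-. Qed.

Lemma coef_tableau_gf_count b mu n : fps_coef (tableau_gf b mu) n =
  (#|[pred T | tableau mu b T & total T == n]|%:R)%R.
Proof.
rewrite -sumr_const.
rewrite fps_coef_sum [LHS](bigID (fun T : {ffun Y -> 'I_B.+1} => total T == n)) /=.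
rewrite [X in (_ + X)%R]big1 ?addr0 => [|T /andP[_ ne]]; last first.
  by rewrite coef_fpsXn eq_sym (negbTE ne).
by apply: eq_bigr => T /andP[_ /eqP->]; rewrite coef_fpsXn eqxx.
Qed.

Lemma tableau_gf_self mu b : (forall i, 0 < i <= d -> mu i = lam i) -> tableau_gf b mu = 1%R.
Proof.
move=> muE; have all_inner c : inner mu c.
  by rewrite /inner; have /and4P[r0 rd _ clam] := cellP c; rewrite muE ?r0.
pose T0 : {ffun Y -> 'I_B.+1} := [ffun=> ord0].
rewrite /tableau_gf (big_pred1 T0) => [|T].
  by rewrite /total big1 ?expr0 // => c _; rewrite ffunE.
apply/tableauP/eqP => [[T_0 _ _ _]|->].
  by apply/ffunP => c; apply: val_inj; rewrite /= T_0 // ffunE.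
by split=> [c|c|c c'|c c']; rewrite ?all_inner // ffunE.
Qed.

Lemma qdet_same mu : (forall i, 0 < i <= d -> mu i = lam i) -> qdet R d lam mu = 1%R.
Proof.
move=> muE; have [lam_ni _ _] := lam_sh; rewrite -(qdet_self R d lam_ni).
congr (\det _)%R; apply/matrixP => i j; rewrite !mxE /pos muE //.
by rewrite ltn_ord.
Qed.

(** Both sides obey the same recurrence. The term of [nu = lam] is 1 on both; any other carries a
    positive power of [q], which lowers [n] and so makes the smaller bound [b] sufficient. *)
Theorem coef_tableau_gf b mu n : n < b -> b <= B.+1 -> is_shape d N mu ->
  (forall i, mu i <= lam i) ->
  fps_coef (tableau_gf b mu) n = fps_coef (qdet R d lam mu) n.
Proof.
elim: b mu n => // b IH mu n lt_nb bB mu_sh mu_lam.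
rewrite tableau_gf_rec // (qdet_rec R lam_sh mu_sh) !fps_coef_sum.
apply: eq_bigr => nu /andP[inter /forallP sub].
have nu_sh := shape_of_is_shape inter.
set k := \sum_(i < d) _; have [k0|k0] := posnP k.
  have nuE i : 0 < i <= d -> shape_of nu i = lam i.
    case: i => // i id; rewrite (shape_ofE nu (Ordinal (id : i < d))).
    move/eqP: k0; rewrite sum_nat_eq0 => /forallP/(_ (Ordinal (id : i < d))) /=.
    by have := sub (Ordinal (id : i < d)); rewrite /=; lia.
  by rewrite tableau_gf_self // qdet_same.
have [lt_nk|le_kn] := ltnP n k; first by rewrite !coef_fpsXM_low.
rewrite -(subnKC le_kn) !coef_fpsXM IH //; try lia.
move=> [|i]; first by have [_ -> _] := lam_sh.
have [id|di] := ltnP i d; last by rewrite shape_of_out.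
by rewrite (shape_ofE nu (Ordinal id)); exact: sub (Ordinal id).
Qed.

End GeneratingFunction.

(** * The skew Schur function *)

(** At index 0 [part] returns the first part; the bound [N], common to both partitions, takes its
    place. *)
Definition shape_seq (N : nat) (mu : seq nat) (i : nat) := if i == 0 then N else part mu i.

Lemma noninc_part mu : is_partition mu -> noninc (part mu).
Proof.
case/andP => mu_sorted _ [|i]; first by [].
rewrite /part /=; have [lt_i|le_i] := ltnP i.+1 (size mu); last by rewrite nth_default.
exact: (sortedP 0 mu_sorted).
Qed.

Lemma cell_shape_seq N mu : cell (shape_seq N mu) = cell (part mu).
Proof. by apply/funext => -[[|i] j]. Qed.

Lemma mem_young la z : (z \in young la) = cell (part la) z.
Proof.
rewrite -[young la]/(cells (size la) (part la)) mem_cells andb_idl //.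
case: z => [[//|i] j] /and3P[/= _ j0]; rewrite /part /=.
by have [//|le] := ltnP i (size la); rewrite nth_default //; lia.
Qed.

Section Bridge.
Variables (la mu : seq nat).
Hypotheses (la_part : is_partition la) (mu_part : is_partition mu).
Hypothesis mu_sub_la : young mu `<=` young la.

Let d := size la.
Let N := part la 1.
Let lam' := shape_seq N la.
Let mu' := shape_seq N mu.

Let part_le i : 0 < i -> part mu i <= part la i.
Proof.
move=> i0; have [->//|mui] := posnP (part mu i).
have : (i, part mu i) \in young mu by rewrite mem_young /cell /= i0 mui leqnn.
by move/(fsubsetP mu_sub_la); rewrite mem_young => /and3P[].
Qed.

Lemma shape_la : is_shape d N lam'.
Proof.
split=> //; last by rewrite /lam' /shape_seq /part /= nth_default.
by move=> [|i] //; exact: (noninc_part la_part).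
Qed.

Lemma shape_mu : is_shape d N mu'.
Proof.
split=> //.
  by move=> [|i]; [exact: part_le|exact: (noninc_part mu_part)].
by have := @part_le d.+1 isT; rewrite /mu' /shape_seq {2}/part /= nth_default //; lia.
Qed.

Lemma mu_le_la i : mu' i <= lam' i.
Proof. by case: i => // i; exact: part_le. Qed.

Lemma young_cells : young la = cells d lam'.
Proof. by apply/fsetP => z; rewrite mem_young (mem_shape _ shape_la) cell_shape_seq. Qed.

Lemma excited_slid : excited_diagrams la mu = slid_diagrams d lam' mu'.
Proof.
have la_ni := noninc_part la_part; have mu_ni := noninc_part mu_part.
apply/fsetP => S; rewrite in_fset; apply/andP/(slid_diagramsP _ _ shape_la).
  case; rewrite fpowersetE => S_la /asboolP /(excited_slides mu_ni (@mem_young mu)) [e rppe Se].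
  exists e; split.
  - by rewrite /rpp cell_shape_seq.
  - by rewrite /slides cell_shape_seq.
  - by move=> z /(fsubsetP S_la); rewrite mem_young cell_shape_seq.
case=> e [rppe Se sub]; rewrite /rpp /slides cell_shape_seq in rppe Se.
have S_la : S `<=` young la.
  by apply/fsubsetP => z /sub; rewrite mem_young cell_shape_seq.
split; first by rewrite fpowersetE.
apply/asboolP; apply: (slides_excited (e := e)) => //.
- exact: mem_young.
- exact: mem_young.
- exact/fsubsetP.
Qed.

Lemma conj_partE j : conj_part la j = column_length d lam' j.
Proof. by rewrite /conj_part -sum1_count big_mkcond (big_nth 0) big_mkord. Qed.

Lemma hookE c : c \in young la -> hook la c = hook_length d lam' c.
Proof.
rewrite mem_young => /and3P[c1 _ _]; rewrite /hook /hook_length conj_partE.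
by rewrite /lam' /shape_seq; case: eqP c1 => [->|].
Qed.

Lemma skew_sub : skew la mu `<=` cells d lam'.
Proof. by rewrite -young_cells; apply: fsubsetDl. Qed.

Lemma mem_skew (c : cells d lam') : (val c \in skew la mu) = ~~ inner mu' c.
Proof.
have /and4P[r0 _ c0 _] := cellP c.
have cla : val c \in young la by rewrite young_cells; exact: valP.
rewrite in_fsetD cla andbT mem_young -(cell_shape_seq N) /cell /inner -/mu'.
by rewrite /rowc /colc in r0 c0 *; rewrite r0 c0.
Qed.

(** * Tableaux of weight [n] as bounded fillings of the whole diagram *)

Section Coefficient.
Variable n : nat.
Implicit Types T : {ffun cells d lam' -> 'I_n.+1}.

Definition restrict T : {ffun skew la mu -> nat} := [ffun c => T (fincl skew_sub c) : nat].

(** Meant for fillings of weight [n], whose entries are at most [n] and thus kept by [inord]; the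
    cells of [mu] receive 0. *)
Definition extend (T : {ffun skew la mu -> nat}) : {ffun cells d lam' -> 'I_n.+1} :=
  [ffun c => if insub (val c) is Some s then inord (T s) else ord0].

Lemma restrictE T (c : skew la mu) (c' : cells d lam') : val c = val c' ->
  restrict T c = T c' :> nat.
Proof. by move=> E; rewrite ffunE; congr (T _ : nat); apply: val_inj. Qed.

Lemma weight_restrict T : tableau mu' n.+1 T -> weight (restrict T) = total T.
Proof.
case/tableauP => T0 _ _ _.
pose g z := if insub z is Some c then T c : nat else 0.
have gE (c : cells d lam') : g (val c) = T c by rewrite /g valK.
transitivity (\sum_(z <- skew la mu) g z).
  rewrite big_seq_fsetE; apply: eq_bigr => c _.
  by rewrite (restrictE T (c' := fincl skew_sub c)) // -gE.
rewrite (big_fset_incl _ skew_sub) => [|z zY nz].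
  by rewrite big_seq_fsetE; apply: eq_bigr => c _; rewrite gE.
rewrite -[z]/(val [` zY]) gE; apply: T0.
by move: nz; rewrite -[z]/(val [` zY]) mem_skew negbK.
Qed.

Lemma restrict_ssyt T : tableau mu' n.+1 T -> ssyt (restrict T).
Proof.
case/tableauP => _ _ Trow Tcol; have ninner (c : skew la mu) : ~~ inner mu' (fincl skew_sub c).
  by rewrite -mem_skew; exact: (valP c).
by split=> c c' E le; rewrite !ffunE; [apply: Trow|apply: Tcol].
Qed.

Lemma restrict_inj T T' : tableau mu' n.+1 T -> tableau mu' n.+1 T' ->
  restrict T = restrict T' -> T = T'.
Proof.
move=> /tableauP[T0 _ _ _] /tableauP[T0' _ _ _] /ffunP E.
apply/ffunP => c; apply: val_inj => /=.
have [ci|] := boolP (inner mu' c); first by rewrite T0 // T0'.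
by rewrite -mem_skew => cs; have := E [` cs]; rewrite !(@restrictE _ _ c).
Qed.

Lemma extendE (T : {ffun skew la mu -> nat}) (c : cells d lam') (s : skew la mu) :
  weight T = n -> val c = val s -> extend T c = T s :> nat.
Proof.
move=> wT E; rewrite ffunE E valK inordK // ltnS -wT /weight.
by rewrite (bigD1 s) //= leq_addr.
Qed.

Lemma extend_tableau (T : {ffun skew la mu -> nat}) : ssyt T -> weight T = n ->
  tableau mu' n.+1 (extend T).
Proof.
move=> [Trow Tcol] wT; have [mu_ni _ _] := shape_mu.
have outer (c : cells d lam') : ~~ inner mu' c -> exists s : skew la mu, val s = val c.
  by rewrite -mem_skew => cs; exists [` cs].
apply/tableauP; split=> [c|c _|c c' nc E le|c c' nc E lt].
- move=> ci; rewrite ffunE insubF //; apply/negbTE.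
  by rewrite mem_skew ci.
- exact: ltn_ord.
- have [s sE] := outer c nc; have [|s' sE'] := outer c'.
    by move: nc; rewrite /inner E; lia.
  rewrite (extendE wT (esym sE)) (extendE wT (esym sE')).
  by apply: Trow; rewrite sE sE'.
- have [s sE] := outer c nc; have [|s' sE'] := outer c'.
    by move: nc; rewrite /inner E; have := noninc_le mu_ni (ltnW lt); lia.
  rewrite (extendE wT (esym sE)) (extendE wT (esym sE')).
  by apply: Tcol; rewrite sE sE'.
Qed.

Lemma coef_skew_schur :
  fps_coef (skew_schur_ps la mu) n = fps_coef (tableau_gf int d n lam' n.+1 mu') n.
Proof.
pose P := [pred T : {ffun cells d lam' -> 'I_n.+1} | tableau mu' n.+1 T && (total T == n)].
rewrite /skew_schur_ps /fps_sum /= (fsbigE [seq restrict T | T <- enum P]).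
- rewrite coef_tableau_gf_count big_map big_enum_cond /=.
  rewrite (eq_bigl (mem P)) => [|T]; last first.
    apply: andb_idr => /andP[tT _]; rewrite inE; exact: restrict_ssyt.
  rewrite (eq_bigr (fun=> 1%R)) => [|T /andP[tT /eqP wT]]; last first.
    by rewrite coef_fpsXn weight_restrict // wT eqxx.
  by rewrite sumr_const.
- rewrite map_inj_in_uniq ?enum_uniq // => T T'; rewrite !mem_enum.
  by move=> /andP[tT _] /andP[tT' _]; apply: restrict_inj.
- move=> T /mapP[T' + ->]; rewrite mem_enum => /andP[tT' _]; exact: restrict_ssyt.
(* A tableau contributing to this coefficient has weight [n], hence is the restriction of its
   extension. *)
move=> T tT; rewrite coef_fpsXn; case: eqP => // /esym wT /negP[].
apply/mapP; exists (extend T); last first.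
  by apply/ffunP => s; rewrite ffunE (extendE (s := s)).
have tE := extend_tableau tT wT; rewrite mem_enum inE tE /=.
have -> : total (extend T) = weight (restrict (extend T)) by rewrite weight_restrict.
rewrite -wT; apply/eqP; apply: eq_bigr => s _.
by rewrite ffunE (extendE (s := s)).
Qed.

End Coefficient.
End Bridge.

Local Open Scope ring_scope.

Theorem theorem1p4 (la mu : seq nat)
    (la_part : is_partition la) (mu_part : is_partition mu)
    (mu_sub_la : young mu `<=` young la) :
  skew_schur_ps la mu =
  \sum_(S <- excited_diagrams la mu)
    \prod_(c <- young la `\` S)
      (fpsX ^+ (conj_part la c.2 - c.1)%N / (1 - fpsX ^+ hook la c)).
Proof.
have la_sh := shape_la la_part.
have mu_sh := shape_mu la_part mu_part mu_sub_la.
rewrite (excited_slid la_part mu_part).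
transitivity (qdet int (size la) (shape_seq (part la 1) la) (shape_seq (part la 1) mu)).
  apply/fpsP => n; rewrite (coef_skew_schur la_part mu_part mu_sub_la).
  by apply: (coef_tableau_gf _ la_sh) => //; exact: mu_le_la.
rewrite (qdet_hook _ la_sh mu_sh); apply: eq_bigr => S _.
rewrite -young_cells //; apply: eq_big_seq => c; rewrite in_fsetD => /andP[_ cla].
by rewrite hookE // conj_partE.
Qed.
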